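(* Let $n\ge 1$ and let $\varphi:\mathbb{C}^n\to\mathbb{C}^n$ be a mapping such that the composition operator $C_\varphi f=f\circ\varphi$ is a bounded operator on the Fock space $\mathcal{H}(\mathbb{C}^n)$. Then $C_\varphi$ is norm attaining, i.e. there exists $f\in\mathcal{H}(\mathbb{C}^n)$ with $\|f\|=1$ and $\|C_\varphi f\|=\|C_\varphi\|$.
   Context: Inner products are linear in the first variable. The Fock (Segal-Bargmann) space $\mathcal{H}(\mathbb{C}^n)$ is the reproducing kernel Hilbert space of entire functions on $\mathbb{C}^n$ with reproducing kernel $K(z,w)=K_w(z)=\exp\langle z,w\rangle$ for $z,w\in\mathbb{C}^n$, so that $\langle f,K_w\rangle=f(w)$ for all $f\in\mathcal{H}(\mathbb{C}^n)$. *)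

(* Defs.v *)
From HB Require Import structures.
From mathcomp Require Import all_boot all_order all_algebra complex.
From mathcomp Require Import all_classical all_reals all_analysis.

Set Implicit Arguments.
Unset Strict Implicit.
Unset Printing Implicit Defensive.

Import Order.TTheory GRing.Theory Num.Theory numFieldNormedType.Exports.

Local Open Scope classical_set_scope.
Local Open Scope complex_scope.
Local Open Scope ring_scope.

(* exp (x + iy) = e^x (cos y + i sin y) *)
Definition cexp {R : realType} (z : R[i]) : R[i] :=
  (expR (complex.Re z))%:C * (cos (complex.Im z) +i* sin (complex.Im z)).

Definition cdot {R : realType} {n : nat} (z w : 'rV[R[i]]_n) : R[i] :=
  \sum_(j < n) z 0 j * (w 0 j)^*.

(* The scalar field is R[i], so [differentiable] is complex Frechet
   differentiability; [R[i]^o] is R[i] as a normed module over itself. *)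
Definition entire {R : realType} {n : nat} (f : 'rV[R[i]]_n -> R[i]) : Prop :=
  forall z : ('rV[R[i]]_n : normedModType R[i]),
    differentiable (f : 'rV[R[i]]_n -> R[i]^o) z.

(* The inner product is a complex number; its diagonal values are nonnegative
   reals, whence the real part. *)
Definition dot_norm {R : realType} {V : lmodType R[i]}
    (dot : {dot V for (@Num.conj R[i])}) (f : V) : R :=
  Num.sqrt (complex.Re (dot f f)).

Definition dot_complete {R : realType} {V : lmodType R[i]}
    (dot : {dot V for (@Num.conj R[i])}) : Prop :=
  forall u : nat -> V,
    (forall e : R, 0 < e -> exists N : nat, forall p q : nat,
        (N <= p)%N -> (N <= q)%N -> dot_norm dot (u p - u q) < e) ->
    exists l : V, dot_norm dot (u k - l) @[k --> \oo] --> (0 : R).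

(* A Hilbert space of functions on X with reproducing kernel K.  The injective
   linear map [rkhs_fun] identifies an element of the space with a function.
   A [{dot V for conj}] is linear in its first argument, conjugate-linear in the
   second one, Hermitian and positive definite.  By Moore-Aronszajn, K
   determines such a space up to an isometry compatible with [rkhs_fun]. *)
Record rkhs (R : realType) (X : Type) (K : X -> X -> R[i]) := Rkhs {
  rkhs_sort :> lmodType R[i];
  rkhs_fun : {linear rkhs_sort -> (X -> R[i])};
  rkhs_dot : {dot rkhs_sort for (@Num.conj R[i])};
  rkhs_ker : X -> rkhs_sort;
  rkhs_fun_inj : injective rkhs_fun;
  rkhs_complete : dot_complete rkhs_dot;
  rkhs_kerE : forall w z : X, rkhs_fun (rkhs_ker w) z = K z w;
  rkhs_reproducing : forall (f : rkhs_sort) (w : X),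
    rkhs_dot f (rkhs_ker w) = rkhs_fun f w
}.

Arguments rkhs_fun {R X K r}.
Arguments rkhs_dot {R X K r}.
Arguments rkhs_ker {R X K r}.

Record fock_space (R : realType) (n : nat) := FockSpace {
  fock_rkhs :> rkhs (fun z w : 'rV[R[i]]_n => cexp (cdot z w));
  fock_entire : forall f : fock_rkhs, entire (rkhs_fun f)
}.

Definition hnorm {R : realType} {X : Type} {K : X -> X -> R[i]} {H : rkhs K}
    (f : H) : R :=
  dot_norm rkhs_dot f.

Definition bounded_operator {R : realType} {X : Type} {K : X -> X -> R[i]}
    {H : rkhs K} (T : {linear H -> H}) : Prop :=
  exists M : R, forall f : H, hnorm (T f) <= M * hnorm f.

Definition operator_norm {R : realType} {X : Type} {K : X -> X -> R[i]}
    {H : rkhs K} (T : {linear H -> H}) : R :=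
  sup [set hnorm (T f) | f in [set f : H | hnorm f <= 1]].

Definition norm_attaining {R : realType} {X : Type} {K : X -> X -> R[i]}
    {H : rkhs K} (T : {linear H -> H}) : Prop :=
  exists f : H, hnorm f = 1 /\ hnorm (T f) = operator_norm T.

(* T is the everywhere defined operator C_phi on H; in particular f \o phi lies
   in H for every f in H.  By [rkhs_fun_inj] there is at most one such T. *)
Definition is_composition_operator {R : realType} {X : Type}
    {K : X -> X -> R[i]} {H : rkhs K} (phi : X -> X) (T : {linear H -> H}) :
    Prop :=
  forall f : H, rkhs_fun (T f) = rkhs_fun f \o phi.

(* Main.v *)
Require Import Defs.
From HB Require Import structures.
From mathcomp Require Import all_boot all_order all_algebra complex.
From mathcomp Require Import all_classical all_reals all_analysis.
From mathcomp Require Import sesquilinear spectral cyclic separable cyclotomic.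
From mathcomp Require Import ring lra.

Set Implicit Arguments.
Unset Strict Implicit.
Unset Printing Implicit Defensive.

Import Order.TTheory GRing.Theory Num.Theory numFieldNormedType.Exports.
Import ComplexField.Normc.

Local Open Scope classical_set_scope.
Local Open Scope ring_scope.

(** Write [K z w = exp <z, w>] and [K_w] for the kernel functions.  The adjoint
    of the composition operator maps [K_z] to [K_(phi z)], so boundedness with
    constant [M] says exactly that the kernel
    [M^2 exp <z, w> - exp <phi z, phi w>] is positive semidefinite
    ([qform_push_le], [composition_le]); the converse direction needs that the
    kernel functions span a dense subspace ([comb_dense]).

    This kernel inequality makes [phi] affine.  On the diagonal it gives
    [|phi z|^2 <= |z|^2 + c].  Since [exp <phi z, phi w> - <phi z, phi w>] is
    positive semidefinite (Schur products of the exponential series,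
    [psd_cexp_cdot]), it also bounds every combination of values of [phi] by the
    norm of the same combination of kernel functions.  On a complex line through
    the origin the latter norm is a weighted sum of squared moments, so that
    [phi] is there a limit of the polynomials interpolating it at roots of unity
    on large circles; their coefficients are averages of [phi], hence small
    beyond degree one ([linear_growth_affine]).  Additivity across lines
    comes from [K_(t(u+v)) - K_(tu) - K_(tv) + K_0] being of order [t^2] in norm
    ([qform_fock_dilation_le], [phi_affine]).

    For [phi z = z A + b] the function [|phi z|^2 - |z|^2] is a quadratic
    polynomial bounded above, so it has a maximum [c] at some [w], and completing
    the square there gives a matrix [B] with
    [<z, u> + c = <phi z, phi u> + <(z - w) B, (u - w) B>]
    ([complete_square]).  Exponentiating, [e^c exp <z, u>] is the product of
    [exp <phi z, phi u>] with the exponential of a positive semidefinite kernel,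
    and subtracting [exp <phi z, phi u>] leaves a positive semidefinite kernel.
    Hence the operator has norm at most [e^(c/2)].  This is the ratio
    [|K_(phi w)| / |K_w|], which the normalised kernel function at [phi w]
    reaches ([norm_attaining_kernel]). *)

(** * Complex numbers and the complex exponential *)

Section ComplexModulus.
Variable R : rcfType.
Implicit Types (x y z : R[i]) (c : R).

Lemma normc_ge0 z : 0 <= normc z.
Proof. by case: z => a b; rewrite sqrtr_ge0. Qed.

Lemma sqr_normc_Re z : normc z ^+ 2 = complex.Re (z * z^*).
Proof.
case: z => a b /=; rewrite sqr_sqrtr ?addr_ge0 ?sqr_ge0 //.
by rewrite mulrN opprK -!expr2.
Qed.

Lemma normc_conj z : normc (z^*) = normc z.
Proof. by case: z => a b /=; rewrite sqrrN. Qed.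

Lemma normc_Re z : `|complex.Re z| <= normc z.
Proof. by case: z => a b /=; rewrite -sqrtr_sqr ler_wsqrtr // lerDl sqr_ge0. Qed.

Lemma normc_real c : normc (real_complex R c) = `|c|.
Proof. by rewrite /= expr0n addr0 sqrtr_sqr. Qed.

Lemma normcX z k : normc (z ^+ k) = normc z ^+ k.
Proof. by elim: k => [|k IH]; rewrite ?expr0 ?normc1 // !exprS normcM IH. Qed.

Lemma normc_nat (k : nat) : normc (k%:R : R[i]) = k%:R.
Proof. by rewrite -(rmorph_nat (real_complex R)) normc_real ger0_norm. Qed.

Lemma normc_sum (I : Type) (s : seq I) (F : I -> R[i]) :
  normc (\sum_(i <- s) F i) <= \sum_(i <- s) normc (F i).
Proof.
elim: s => [|i s IH]; first by rewrite !big_nil normc0.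
by rewrite !big_cons; apply: le_trans (le_normcD _ _) _; rewrite lerD2l.
Qed.

Lemma ReD x y : complex.Re (x + y) = complex.Re x + complex.Re y.
Proof. by case: x; case: y. Qed.

Lemma Re_sum (I : Type) (s : seq I) (F : I -> R[i]) :
  complex.Re (\sum_(i <- s) F i) = \sum_(i <- s) complex.Re (F i).
Proof. exact: (big_morph _ ReD erefl). Qed.

Lemma ReN x : complex.Re (- x) = - complex.Re x.
Proof. by case: x. Qed.

Lemma ReB x y : complex.Re (x - y) = complex.Re x - complex.Re y.
Proof. by rewrite ReD ReN. Qed.

Lemma Re_realM c x : complex.Re (real_complex R c * x) = c * complex.Re x.
Proof. by case: x => a b /=; rewrite mul0r subr0. Qed.

Lemma conj_real c : (real_complex R c)^* = real_complex R c.
Proof. exact: conjc_real. Qed.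

Lemma real_complex_eq0 c : (real_complex R c == 0) = (c == 0).
Proof. by rewrite eq_complex /= eqxx andbT. Qed.

Lemma sqr_normcJ z : real_complex R (normc z ^+ 2) = z * z^*.
Proof. by rewrite rmorphXn; exact: sqr_normc. Qed.

Lemma Re_conjc x : complex.Re x^* = complex.Re x.
Proof. by case: x. Qed.

End ComplexModulus.

Section ComplexExponential.
Variable R : realType.
Implicit Types (c z : R[i]) (t : R).

Definition cexp_partial (n : nat) (z : R[i]) : R[i] :=
  \sum_(k < n) z ^+ k / k`!%:R.

(** Monotonicity of [g + f] and [g - f]; a mean value inequality that needs no integral. *)
Lemma is_derive_norm_le (f g df dg : R -> R) T :
  (forall t, is_derive t 1 f (df t)) -> (forall t, is_derive t 1 g (dg t)) ->
  f 0 = 0 -> g 0 = 0 -> (forall t, 0 <= t -> t <= T -> `|df t| <= dg t) ->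
  forall t, 0 <= t -> t <= T -> `|f t| <= g t.
Proof.
move=> Hf Hg f0 g0 H t t0 tT.
have key (h dh : R -> R) : (forall t, is_derive t 1 h (dh t)) -> h 0 = 0 ->
    (forall t, 0 <= t -> t <= T -> 0 <= dh t) -> 0 <= h t.
  move=> Hh h0 Hd; rewrite -h0.
  apply: (@ger0_derive1_ndecr _ h 0 T) => //.
  - move=> x; rewrite in_itv /= => /andP[/ltW x0 /ltW xT].
    by rewrite derive1E derive_val Hd.
  - apply: continuous_subspaceT => x.
    by apply: differentiable_continuous; apply/derivable1_diffP.
rewrite ler_norml; apply/andP; split.
- rewrite -subr_ge0 opprK addrC.
  apply: (key (fun x => g x + f x) (fun x => dg x + df x)).
  + by rewrite f0 g0 addr0.
  + move=> x x0 /(H _ x0); rewrite ler_norml => /andP[].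
    by rewrite -subr_ge0 opprK addrC.
- rewrite -subr_ge0; apply: (key (fun x => g x - f x) (fun x => dg x - df x)).
  + by rewrite f0 g0 subr0.
  + by move=> x x0 /(H _ x0); rewrite ler_norml subr_ge0 => /andP[].
Qed.

(** Real-valued, so that the one-variable derivative applies: pairing with an
    arbitrary complex [c] treats the real and imaginary parts together, and
    differentiating in [t] only replaces [c] by [c * z]. *)
Definition cexp_remainder (n : nat) c z t : R :=
  complex.Re (c * (cexp (real_complex R t * z)
    - cexp_partial n (real_complex R t * z))).

Lemma is_derive_cexp c z t :
  is_derive t 1 (fun t => complex.Re (c * cexp (real_complex R t * z)))
    (complex.Re (c * z * cexp (real_complex R t * z))).
Proof.
case: c z => [c1 c2] [a b].
have E x d1 d2 : complex.Re (Complex d1 d2 * cexp (real_complex R x * Complex a b)) =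
    expR (x * a) * (d1 * cos (x * b) - d2 * sin (x * b)).
  by rewrite /cexp /=; rewrite !mul0r !subr0 !addr0; ring.
rewrite (_ : (fun _ => _) = (fun x =>
    expR (x * a) * (c1 * cos (x * b) - c2 * sin (x * b)))); last first.
  by apply/funext => x; rewrite E.
have dl d : is_derive t 1 (fun x => x * d) d.
  by apply: is_derive_eq; rewrite /GRing.scale /= mulr1 mulr0 add0r.
have dE := @is_derive1_comp _ expR (fun x => x * a) t _ _ (is_derive_expR (t * a)) (dl a).
have dC := @is_derive1_comp _ cos (fun x => x * b) t _ _ (is_derive_cos (t * b)) (dl b).
have dS := @is_derive1_comp _ sin (fun x => x * b) t _ _ (is_derive_sin (t * b)) (dl b).
apply: is_derive_eq.
rewrite (E t (c1 * a - c2 * b) (c1 * b + c2 * a)) /GRing.scale /=.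
ring.
Qed.

Lemma is_derive_exprS n t :
  is_derive t 1 (fun x : R => x ^+ n.+1) (n.+1%:R * t ^+ n).
Proof.
have := @is_deriveX _ _ id n.+1 t 1 1 _.
rewrite /= {1}/GRing.scale /= mulr1 => /(_ (is_derive_id _ _)).
by rewrite exprfctE.
Qed.

Lemma is_derive_monomial c z k t :
  is_derive t 1 (fun t => complex.Re (c * ((real_complex R t * z) ^+ k / k`!%:R)))
    (if k is k'.+1 then
       complex.Re (c * z * ((real_complex R t * z) ^+ k' / k'`!%:R)) else 0).
Proof.
have E x d j : complex.Re (d * ((real_complex R x * z) ^+ j / j`!%:R)) =
    x ^+ j * (complex.Re (d * z ^+ j) / j`!%:R).
  rewrite exprMn -rmorphXn -(rmorph_nat (real_complex R) j`!) -fmorphV.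
  rewrite [LHS](_ : _ = complex.Re (real_complex R (x ^+ j / j`!%:R) * (d * z ^+ j))).
    by rewrite Re_realM; ring.
  by congr complex.Re; rewrite rmorphM; ring.
rewrite (_ : (fun _ => _) = (fun x =>
   x ^+ k * (complex.Re (c * z ^+ k) / k`!%:R))); last first.
  by apply/funext => x; rewrite E.
case: k => [|k].
  rewrite (_ : (fun _ => _) = cst (complex.Re (c * z ^+ 0) / 0`!%:R)); last first.
    by apply/funext => x; rewrite expr0 mul1r.
  exact: is_derive_cst.
have hX := is_derive_exprS k t.
apply: is_derive_eq.
rewrite E (exprS z) (mulrA c) /GRing.scale /= factS natrM.
field.
by rewrite nat1r !pnatr_eq0 -lt0n fact_gt0.
Qed.

Lemma is_derive_cexp_remainder n c z t :
  is_derive t 1 (cexp_remainder n.+1 c z) (cexp_remainder n (c * z) z t).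
Proof.
have E m d x : cexp_remainder m d z x =
    complex.Re (d * cexp (real_complex R x * z)) -
    \sum_(k < m) complex.Re (d * ((real_complex R x * z) ^+ k / k`!%:R)).
  by rewrite /cexp_remainder mulrBr ReB mulr_sumr Re_sum.
rewrite (_ : cexp_remainder n.+1 c z = (fun x => 
   complex.Re (c * cexp (real_complex R x * z)) -
   (\sum_(k < n.+1) (fun x => complex.Re (c * ((real_complex R x * z) ^+ k / k`!%:R)))) x)); last first.
  by apply/funext => x; rewrite E fct_sumE.
have dc := is_derive_cexp c z t.
have ds := is_derive_sum (fun k : 'I_n.+1 => is_derive_monomial c z k t).
apply: is_derive_eq.
by rewrite E big_ord_recl add0r.
Qed.

Lemma normc_cexp z : normc (cexp z) = expR (complex.Re z).
Proof.
case: z => a b; rewrite /cexp normcM normc_real ger0_norm ?expR_ge0 //=.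
by rewrite cos2Dsin2 sqrtr1 mulr1.
Qed.

Lemma cexp0 : cexp (0 : R[i]) = 1.
Proof. by rewrite /cexp /= expR0 cos0 sin0 mul1r. Qed.

Lemma cexpD (x y : R[i]) : cexp (x + y) = cexp x * cexp y.
Proof.
case: x => a b; case: y => c d; rewrite /cexp /= expRD cosD sinD.
rewrite rmorphM mulrACA; congr (_ * _).
by apply/eqP; rewrite eq_complex /= eqxx addrC eqxx.
Qed.

Lemma cexp_real (x : R) : cexp (real_complex R x) = real_complex R (expR x).
Proof. by rewrite /cexp /= cos0 sin0 mulr1. Qed.

(** Induction on [n]: by [is_derive_cexp_remainder] the derivative of one remainder
    is the previous one with [c * z] in place of [c], and the bounding function
    integrates in the same way. *)
Lemma cexp_remainder_le n c z t : 0 <= t -> t <= 1 ->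
  `|cexp_remainder n c z t| <=
    normc c * expR (normc z) * ((normc z * t) ^+ n / n`!%:R).
Proof.
elim: n c t => [|n IH] c t t0 t1.
  rewrite /cexp_remainder /cexp_partial big_ord0 subr0 expr0 fact0 divr1 mulr1.
  apply: le_trans (normc_Re _) _; rewrite normcM ler_wpM2l ?normc_ge0 //.
  rewrite normc_cexp ler_expR Re_realM.
  apply: le_trans (ler_norm _) _; rewrite normrM ger0_norm //.
  by apply: le_trans (normc_Re z); rewrite ler_piMl.
apply: (@is_derive_norm_le (cexp_remainder n.+1 c z)
  (fun x => normc c * expR (normc z) * ((normc z * x) ^+ n.+1 / n.+1`!%:R))
  (cexp_remainder n (c * z) z)
  (fun x => normc (c * z) * expR (normc z) * ((normc z * x) ^+ n / n`!%:R)) 1) => //.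
- exact: is_derive_cexp_remainder.
- move=> x.
  have hX := is_derive_exprS n x.
  rewrite (_ : (fun _ => _) = (fun x => 
     x ^+ n.+1 * (normc c * expR (normc z) * (normc z ^+ n.+1 / n.+1`!%:R)))).
    apply: is_derive_eq.
    rewrite normcM exprMn (exprS (normc z)) factS natrM /GRing.scale /=.
    field.
    by rewrite nat1r !pnatr_eq0 -lt0n fact_gt0.
  by apply/funext => y; rewrite exprMn; ring.
- rewrite /cexp_remainder rmorph0 mul0r /cexp_partial big_ord_recl big1 => [|i _].
    by rewrite cexp0 expr0 fact0 divr1 addr0 subrr mulr0.
  by rewrite expr0n mul0r.
- by rewrite mulr0 expr0n mul0r mulr0.
- by move=> y y0 y1; apply: IH.
Qed.

(** Taking [c] to be the conjugate of the remainder itself turns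
    [cexp_remainder_le] into a bound on the modulus. *)
Theorem cexp_taylor n z :
  normc (cexp z - cexp_partial n z) <= expR (normc z) * (normc z ^+ n / n`!%:R).
Proof.
have := @cexp_remainder_le n (cexp z - cexp_partial n z)^* z 1 ler01 (lexx _).
rewrite /cexp_remainder rmorph1 mul1r mulr1 -mulrA normc_conj.
rewrite mulrC -sqr_normc_Re ger0_norm ?sqr_ge0 // expr2.
have [->|nz] := eqVneq (normc (cexp z - cexp_partial n z)) 0.
  by rewrite mulr_ge0 ?expR_ge0 // divr_ge0 // exprn_ge0 // normc_ge0.
by rewrite ler_pM2l // lt_def nz normc_ge0.
Qed.

Lemma cvg_cexp_partial c z :
  complex.Re (c * cexp_partial n z) @[n --> \oo] --> complex.Re (c * cexp z).
Proof.
apply/cvgrPdist_le => e e0.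
have : (normc c * expR (normc z)) * exp_coeff (normc z) n @[n --> \oo] -->
    (normc c * expR (normc z)) * 0.
  by apply: cvgMr; exact: cvg_exp_coeff.
rewrite mulr0 => /cvgrPdist_le /(_ e e0) H; near=> n.
have : `|0 - (normc c * expR (normc z)) * exp_coeff (normc z) n| <= e.
  by near: n; exact: H.
rewrite sub0r normrN; apply: le_trans; apply: le_trans (ler_norm _).
rewrite -ReB -mulrBr; apply: le_trans (normc_Re _) _.
rewrite normcM -mulrA ler_wpM2l ?normc_ge0 //.
apply: le_trans (cexp_taylor _ _) _.
by rewrite ler_wpM2l ?expR_ge0.
Unshelve. all: by end_near.
Qed.

End ComplexExponential.

(** * Positive semidefinite kernels *)

Section PsdKernels.
Variables (R : realType) (X : Type).
Implicit Types (G : X -> X -> R[i]) (s : seq (R[i] * X)).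

(** For a reproducing kernel [G] this is the squared norm of the combination of
    kernel functions with coefficients and centres listed in [s]
    ([sqr_hnorm_comb]).  Hermitian kernels give a real double sum; the real part
    only makes the value a real number. *)
Definition qform G s : R :=
  complex.Re (\sum_(p <- s) \sum_(q <- s) p.1 * (q.1)^* * G q.2 p.2).

Definition psd G := forall s, 0 <= qform G s.

Lemma qformE G s : qform G s =
  \sum_(p <- s) \sum_(q <- s) complex.Re (p.1 * (q.1)^* * G q.2 p.2).
Proof. by rewrite /qform Re_sum; under eq_bigr do rewrite Re_sum. Qed.

Lemma eq_qform G G' s : (forall z w, G z w = G' z w) -> qform G s = qform G' s.
Proof. by move=> E; congr qform; apply/funext => z; apply/funext => w. Qed.

Lemma eq_psd G G' : (forall z w, G z w = G' z w) -> psd G -> psd G'.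
Proof. by move=> E h s; rewrite -(eq_qform s E). Qed.

Lemma qform_sum (I : Type) (r : seq I) (G : I -> X -> X -> R[i]) s :
  qform (fun z w => \sum_(i <- r) G i z w) s = \sum_(i <- r) qform (G i) s.
Proof.
rewrite qformE; under [RHS]eq_bigr do rewrite qformE.
rewrite [RHS]exchange_big /=; apply: eq_bigr => p _.
rewrite [RHS]exchange_big /=; apply: eq_bigr => q _.
by rewrite mulr_sumr Re_sum.
Qed.

Lemma qform_real c G s :
  qform (fun z w => real_complex R c * G z w) s = c * qform G s.
Proof.
rewrite !qformE mulr_sumr; apply: eq_bigr => p _.
rewrite mulr_sumr; apply: eq_bigr => q _.
by rewrite mulrCA Re_realM.
Qed.

Lemma qformB G G' s :
  qform (fun z w => G z w - G' z w) s = qform G s - qform G' s.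
Proof.
rewrite !qformE -sumrB; apply: eq_bigr => p _.
rewrite -sumrB; apply: eq_bigr => q _.
by rewrite mulrBr ReB.
Qed.

Lemma qform_const s :
  qform (fun _ _ : X => 1) s = normc (\sum_(p <- s) p.1) ^+ 2.
Proof.
rewrite sqr_normc_Re /qform; congr complex.Re.
rewrite rmorph_sum mulr_suml; apply: eq_bigr => p _.
by rewrite mulr_sumr; apply: eq_bigr => q _; rewrite mulr1.
Qed.

Lemma psd1 : psd (fun _ _ : X => 1).
Proof. by move=> s; rewrite qform_const sqr_ge0. Qed.

Lemma psd_sum (I : finType) (G : I -> X -> X -> R[i]) (P : pred I) :
  (forall i, P i -> psd (G i)) -> psd (fun z w => \sum_(i | P i) G i z w).
Proof.
move=> h s; rewrite (eq_qform (G' := fun z w =>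
   \sum_(i <- [seq i <- index_enum I | P i]) G i z w)); last first.
  by move=> z w; rewrite big_filter.
rewrite qform_sum big_filter; apply: sumr_ge0 => i /h; exact.
Qed.

Lemma psd_real c G : 0 <= c -> psd G ->
  psd (fun z w => real_complex R c * G z w).
Proof. by move=> c0 h s; rewrite qform_real mulr_ge0. Qed.

(** A rank-one factor is absorbed in the coefficients, which is all of the Schur
    product theorem that kernels given by feature maps need. *)
Lemma qform_rank1 (h : X -> R[i]) G s :
  qform (fun z w => h z * (h w)^* * G z w) s =
  qform G [seq (p.1 * (h p.2)^*, p.2) | p <- s].
Proof.
rewrite /qform big_map; congr complex.Re; apply: eq_bigr => p _.
rewrite big_map; apply: eq_bigr => q _ /=.
by rewrite rmorphM /= conjCK; ring.
Qed.

Lemma psd_rank1 (h : X -> R[i]) G :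
  psd G -> psd (fun z w => h z * (h w)^* * G z w).
Proof. by move=> hG s; rewrite qform_rank1. Qed.

Lemma psd_cdot n (h : X -> 'rV[R[i]]_n) G :
  psd G -> psd (fun z w => cdot (h z) (h w) * G z w).
Proof.
move=> hG; apply: (eq_psd (G := fun z w =>
    \sum_(j < n) h z 0 j * (h w 0 j)^* * G z w)).
  by move=> z w; rewrite /cdot mulr_suml.
by apply: psd_sum => j _; apply: (psd_rank1 (fun z => h z 0 j)).
Qed.

Lemma psd_cdotX n (h : X -> 'rV[R[i]]_n) k G :
  psd G -> psd (fun z w => cdot (h z) (h w) ^+ k * G z w).
Proof.
move=> hG; elim: k => [|k IH].
  by apply: eq_psd hG => z w; rewrite expr0 mul1r.
by apply: eq_psd (psd_cdot h IH) => z w; rewrite exprS mulrA.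
Qed.

Lemma cvg_big_sum (I : Type) (r : seq I) (f : I -> nat -> R) (l : I -> R) :
  (forall i, f i n @[n --> \oo] --> l i) ->
  \sum_(i <- r) f i n @[n --> \oo] --> \sum_(i <- r) l i.
Proof.
move=> cf; elim: r => [|i r IH].
  by rewrite big_nil; under eq_fun do rewrite big_nil; exact: cvg_cst.
by rewrite big_cons; under eq_fun do rewrite big_cons; exact: cvgD.
Qed.

Lemma cvg_qform (G : nat -> X -> X -> R[i]) G' s :
  (forall c z w, complex.Re (c * G n z w) @[n --> \oo] -->
    complex.Re (c * G' z w)) ->
  qform (G n) s @[n --> \oo] --> qform G' s.
Proof.
move=> cG; rewrite qformE; under eq_fun do rewrite qformE.
apply: cvg_big_sum => p; apply: cvg_big_sum => q; exact: cG.
Qed.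

Lemma psd_cvg (G : nat -> X -> X -> R[i]) G' :
  (forall n, psd (G n)) ->
  (forall c z w, complex.Re (c * G n z w) @[n --> \oo] -->
    complex.Re (c * G' z w)) ->
  psd G'.
Proof.
move=> hG cG s; apply: (cvgr_to_ge (cvg_qform cG)).
by apply: nearW => n; apply: hG.
Qed.

(** Every term of the exponential series of a Gram kernel is a positive semidefinite
    kernel, so the series stays so after one term is removed.  Removing the term
    of degree 1 compares [exp <h, h>] with [<h, h>], removing that of degree 0
    compares it with 1. *)
Lemma psd_cexp_cdot n (h : X -> 'rV[R[i]]_n) j G : psd G ->
  psd (fun z w => (cexp (cdot (h z) (h w))
                   - cdot (h z) (h w) ^+ j / j`!%:R) * G z w).
Proof.
move=> hG.
pose Gm m z w := (cexp_partial (m + j.+1) (cdot (h z) (h w))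
                   - cdot (h z) (h w) ^+ j / j`!%:R) * G z w.
apply: (@psd_cvg Gm) => [m | c z w]; last first.
  rewrite /Gm.
  have E (x y : R[i]) : complex.Re (c * ((x - y) * G z w)) =
      complex.Re (c * G z w * x) - complex.Re (c * G z w * y).
    by rewrite -ReB; congr complex.Re; ring.
  rewrite E; under eq_fun do rewrite E.
  apply: cvgB; last exact: cvg_cst.
  by rewrite (cvg_shiftn j.+1 (fun m =>
    complex.Re (c * G z w * cexp_partial m (cdot (h z) (h w))))); 
    exact: cvg_cexp_partial.
have jm : (j < m + j.+1)%N by rewrite ltn_addl.
apply: (@eq_psd (fun z w => \sum_(k < m + j.+1 | k != Ordinal jm)
   (real_complex R (k`!%:R^-1) * (cdot (h z) (h w) ^+ k * G z w)))).
  move=> z w; rewrite /Gm /cexp_partial [in RHS](bigD1 (Ordinal jm)) //=.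
  rewrite addrAC subrr add0r mulr_suml; apply: eq_bigr => k _.
  by rewrite fmorphV rmorph_nat mulrA [_ * _ ^+ k]mulrC.
apply: psd_sum => k _; apply: psd_real; first by rewrite invr_ge0.
exact: psd_cdotX.
Qed.

End PsdKernels.

(** * Reproducing kernel Hilbert spaces *)

Section KernelSpace.
Variables (R : realType) (X : Type) (K : X -> X -> R[i]) (H : rkhs K).
Implicit Types (f g h : H) (s : seq (R[i] * X)).
Local Notation dot := (@rkhs_dot R X K H).

Lemma hnorm_ge0 f : 0 <= hnorm f.
Proof. exact: sqrtr_ge0. Qed.

Lemma dot_self f : dot f f = real_complex R (hnorm f ^+ 2).
Proof.
have := dnorm_ge0 dot f; rewrite /hnorm /dot_norm.
case E : (dot f f) => [a b]; rewrite lecE /= => /andP[/eqP -> a0].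
by rewrite sqr_sqrtr.
Qed.

Lemma sqr_hnorm f : hnorm f ^+ 2 = complex.Re (dot f f).
Proof. by rewrite dot_self. Qed.

Lemma dotC f g : dot f g = (dot g f)^*.
Proof. by rewrite (hermC dot) expr0 mul1r. Qed.

Lemma dotZl (a : R[i]) f g : dot (a *: f) g = a * dot f g.
Proof. exact: (linearZl_LR dot). Qed.

Lemma dotZr (a : R[i]) f g : dot f (a *: g) = a^* * dot f g.
Proof. exact: (linearZr_LR dot). Qed.

Lemma dotNl f g : dot (- f) g = - dot f g.
Proof. exact: (linearNl dot). Qed.

Lemma dotNr f g : dot f (- g) = - dot f g.
Proof. exact: (linearNr dot). Qed.

Lemma dotDl f1 f2 g : dot (f1 + f2) g = dot f1 g + dot f2 g.
Proof. exact: (linearDl dot). Qed.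

Lemma dotDr f g1 g2 : dot f (g1 + g2) = dot f g1 + dot f g2.
Proof. exact: (linearDr dot). Qed.

Lemma dot0r f : dot f 0 = 0.
Proof. exact: (linear0r dot). Qed.

Lemma dot0l f : dot 0 f = 0.
Proof. exact: (linear0l dot). Qed.

Lemma dot_suml (I : Type) (r : seq I) (F : I -> H) f :
  dot (\sum_(i <- r) F i) f = \sum_(i <- r) dot (F i) f.
Proof. exact: (big_morph (dot^~ f) (fun g h => dotDl g h f) (dot0l f)). Qed.

Lemma dot_sumr (I : Type) (r : seq I) (F : I -> H) f :
  dot f (\sum_(i <- r) F i) = \sum_(i <- r) dot f (F i).
Proof. exact: (big_morph (dot f) (dotDr f) (dot0r f)). Qed.

Lemma sqr_hnormD f g :
  hnorm (f + g) ^+ 2 =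
    hnorm f ^+ 2 + hnorm g ^+ 2 + 2 * complex.Re (dot f g).
Proof.
rewrite !sqr_hnorm !dotDl !dotDr !ReD (dotC g f) Re_conjc. 
by ring.
Qed.

Lemma sqr_hnormZ (a : R[i]) f : hnorm (a *: f) ^+ 2 = normc a ^+ 2 * hnorm f ^+ 2.
Proof.
rewrite !sqr_hnorm dotZl dotZr dot_self mulrA mulrC Re_realM.
by rewrite sqr_normc_Re mulrC.
Qed.

Lemma hnormN f : hnorm (- f) = hnorm f.
Proof. by rewrite /hnorm /dot_norm dotNl dotNr opprK. Qed.

(** The multiple of [g] subtracted is the projection when [tau] is the inverse of
    [hnorm g ^+ 2].  Leaving [tau] free avoids dividing by a norm that may vanish. *)
Lemma sqr_hnorm_sub_proj (tau : R) f g :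
  hnorm (f - (real_complex R tau * dot f g) *: g) ^+ 2 =
    hnorm f ^+ 2
    - (2 * tau - tau ^+ 2 * hnorm g ^+ 2) * normc (dot f g) ^+ 2.
Proof.
rewrite sqr_hnormD hnormN sqr_hnormZ normcM normc_real exprMn real_normK ?num_real //.
rewrite dotNr dotZr ReN rmorphM /= conj_real -mulrA Re_realM.
by rewrite (mulrC (dot f g)^*) -sqr_normc_Re; ring.
Qed.

Lemma dot_Cauchy_Schwarz f g : normc (dot f g) <= hnorm f * hnorm g.
Proof.
have [->|g0] := eqVneq g 0.
  by rewrite dot0r normc0 mulr_ge0 ?hnorm_ge0.
have gp : 0 < hnorm g ^+ 2.
  by have := dnorm_gt0 dot g; rewrite g0 dot_self ltcR.
rewrite -ler_sqr ?nnegrE ?normc_ge0 ?mulr_ge0 ?hnorm_ge0 //.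
rewrite exprMn; set G := hnorm g ^+ 2 in gp *.
have := sqr_hnorm_sub_proj G^-1 f g; rewrite -/G.
rewrite (_ : 2 * _ - _ = G^-1); last by field; rewrite gt_eqF.
move=> E; have := sqr_ge0 (hnorm (f - (real_complex R G^-1 * dot f g) *: g)).
by rewrite E subr_ge0 mulrC ler_pdivrMr.
Qed.

Lemma hnormD f g : hnorm (f + g) <= hnorm f + hnorm g.
Proof.
rewrite -ler_sqr ?nnegrE ?addr_ge0 ?hnorm_ge0 // sqr_hnormD.
have := le_trans (ler_norm _) (le_trans (normc_Re _) (dot_Cauchy_Schwarz f g)).
by rewrite sqrrD; lra.
Qed.

Definition comb s : H := \sum_(p <- s) p.1 *: rkhs_ker p.2.

Lemma dot_comb f s : dot f (comb s) = \sum_(p <- s) (p.1)^* * rkhs_fun f p.2.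
Proof.
rewrite /comb dot_sumr; apply: eq_bigr => p _.
by rewrite dotZr rkhs_reproducing.
Qed.

Lemma sqr_hnorm_comb s : hnorm (comb s) ^+ 2 = qform K s.
Proof.
rewrite sqr_hnorm [X in dot X _]/comb dot_suml; congr complex.Re.
apply: eq_bigr => p _; rewrite dotZl dot_comb mulr_sumr.
by apply: eq_bigr => q _; rewrite rkhs_kerE mulrA.
Qed.

Lemma comb_cat s1 s2 : comb (s1 ++ s2) = comb s1 + comb s2.
Proof. by rewrite /comb big_cat. Qed.

Lemma comb_scale (a : R[i]) s :
  comb [seq (a * p.1, p.2) | p <- s] = a *: comb s.
Proof.
rewrite /comb big_map scaler_sumr; apply: eq_bigr => p _.
by rewrite scalerA.
Qed.

Lemma comb1 (a : R[i]) z : comb [:: (a, z)] = a *: rkhs_ker z.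
Proof. by rewrite /comb big_seq1. Qed.

Lemma parallelogram f g h :
  hnorm (f - g) ^+ 2 = 2 * hnorm (h - f) ^+ 2 + 2 * hnorm (h - g) ^+ 2
    - 4 * hnorm (h - 2^-1 *: (f + g)) ^+ 2.
Proof.
have -> : f - g = (h - g) + - (h - f).
  by rewrite opprB [RHS]addrC addrA subrK.
have -> : h - 2^-1 *: (f + g) = 2^-1 *: ((h - g) + (h - f)).
  rewrite addrACA -opprD (addrC g) scalerBr.
  by rewrite -mulr2n -[h *+ 2]scaler_nat scalerA mulVf ?pnatr_eq0 // scale1r.
move: (h - f) (h - g) => u v.
rewrite sqr_hnormZ !sqr_hnormD hnormN dotNr ReN.
have -> : normc (2^-1 : R[i]) = 2^-1.
  by rewrite normcV normc_nat.
by field.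
Qed.

(** The projection argument: a sequence minimising the distance from [f] to the span
    is Cauchy by the parallelogram law, and the difference of [f] and its limit is
    orthogonal to every kernel function, hence vanishes at every point. *)
Lemma comb_dense f (e : R) : 0 < e -> exists s, hnorm (f - comb s) < e.
Proof.
move=> e0.
pose D := [set hnorm (f - comb s) ^+ 2 | s in [set: seq (R[i] * X)]].
have hD : has_inf D.
  split; first by exists (hnorm (f - comb [::]) ^+ 2), [::].
  by exists 0 => _ [s _ <-]; apply: sqr_ge0.
pose d := inf D.
have dle s : d <= hnorm (f - comb s) ^+ 2 by apply: ge_inf hD.2 _ _; exists s.
have near_d k : exists s, hnorm (f - comb s) ^+ 2 < d + k.+1%:R^-1.
  have [||_ [s _ <-] h] := @inf_adherent _ D k.+1%:R^-1; rewrite ?invr_gt0 ?ltr0n //.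
  by exists s.
have {near_d} [S hS] := choice near_d.
have hC p q : hnorm (comb (S p) - comb (S q)) ^+ 2 <= 2 * (p.+1%:R^-1 + q.+1%:R^-1).
  rewrite (parallelogram _ _ f).
  have := dle [seq (2^-1 * p.1, p.2) | p <- S p ++ S q].
  rewrite comb_scale comb_cat; have := hS p; have := hS q.
  move: (p.+1%:R^-1) (q.+1%:R^-1) => a b; lra.
have small x : 0 < x -> exists N : nat, forall p, (N <= p)%N -> p.+1%:R^-1 < x :> R.
  move=> x0; have [N _ hN] := near_infty_natSinv_lt (PosNum x0).
  by exists N => p /hN.
have [l hl] : exists l : H, hnorm (comb (S k) - l) @[k --> \oo] --> (0 : R).
  apply: (rkhs_complete (r := H)) => x x0.
  have [N hN] := small (x ^+ 2 / 4) ltac:(by rewrite divr_gt0 // exprn_gt0).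
  exists N => p q /hN hp /hN hq.
  rewrite -ltr_sqr ?nnegrE ?(ltW x0) ?sqrtr_ge0 //.
  apply: le_lt_trans (hC p q) _; move: hp hq.
  by move: (p.+1%:R^-1) (q.+1%:R^-1) => a b; lra.
have {}hl x : 0 < x -> exists N : nat, forall p, (N <= p)%N -> hnorm (comb (S p) - l) < x.
  move=> x0; move/cvgrPdist_lt : hl => /(_ x x0) [N _ hN].
  by exists N => p /hN /=; rewrite sub0r normrN ger0_norm ?hnorm_ge0.
have fl : f = l.
  apply: (@rkhs_fun_inj _ _ _ H); apply/funext => z.
  apply/eqP; rewrite -subr_eq0; apply/eqP; apply: eq0_normc.
  rewrite -!rkhs_reproducing -dotNl -dotDl; set kz := rkhs_ker z.
  pose tau := (1 + hnorm kz ^+ 2)^-1.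
  have k0 : 0 < 1 + hnorm kz ^+ 2 by rewrite ltr_pwDl // sqr_ge0.
  have tau0 : 0 < tau by rewrite invr_gt0.
  (* Moving [S k] along [kz] cannot bring it closer to [f] than the infimum [d].
     The step [tau] is of the order of the optimal one but is defined even when
     [kz] is zero. *)
  have far k : tau * normc (dot (f - comb (S k)) kz) ^+ 2 < k.+1%:R^-1.
    have := sqr_hnorm_sub_proj tau (f - comb (S k)) kz.
    set t := real_complex R tau * _ => E.
    have := dle (S k ++ [:: (t, z)]); rewrite comb_cat comb1 opprD addrA E.
    have tk : tau * (1 + hnorm kz ^+ 2) = 1 by rewrite mulVf ?gt_eqF.
    have := hS k; move: (sqr_ge0 (normc (dot (f - comb (S k)) kz))).
    move: (k.+1%:R^-1) (normc _ ^+ 2) (hnorm (f - comb _) ^+ 2) => a A F A0 h1 h2.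
    have -> : tau * A = (2 * tau - tau ^+ 2 * hnorm kz ^+ 2) * A - tau ^+ 2 * A.
      transitivity ((2 * tau - tau * (tau * (1 + hnorm kz ^+ 2))) * A).
        by rewrite tk; ring.
      by ring.
    have := mulr_ge0 (sqr_ge0 tau) A0; lra.
  apply/eqP; rewrite eq_le normc_ge0 andbT leNgt; apply/negP => a0.
  set a := normc _ in a0.
  have [N1 hN1] := small (tau * (a / 2) ^+ 2)
    ltac:(by rewrite mulr_gt0 // exprn_gt0 // divr_gt0).
  have [N2 hN2] := hl (a / 2 / (1 + hnorm kz))
    ltac:(by rewrite !divr_gt0 // ltr_pwDl // hnorm_ge0).
  pose k := maxn N1 N2.
  have h1 : normc (dot (f - comb (S k)) kz) < a / 2.
    rewrite -ltr_sqr ?nnegrE ?normc_ge0 ?divr_ge0 ?(ltW a0) //.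
    rewrite -(ltr_pM2l tau0); apply: lt_trans (far k) _.
    by apply: hN1; rewrite leq_maxl.
  have h2 : normc (dot (comb (S k) - l) kz) <= a / 2.
    apply: le_trans (dot_Cauchy_Schwarz _ _) _.
    have := hN2 k (leq_maxr _ _).
    rewrite ltr_pdivlMr ?ltr_pwDl ?hnorm_ge0 // => /ltW; apply: le_trans.
    by rewrite ler_wpM2l ?hnorm_ge0 // lerDr.
  have : a <= normc (dot (f - comb (S k)) kz) + normc (dot (comb (S k) - l) kz).
    apply: le_trans (le_normcD _ _); rewrite -dotDl addrA subrK; exact: lexx.
  lra.
have [N hN] := hl e e0; exists (S N).
by rewrite fl -hnormN opprB hN.
Qed.

Section Composition.
Variables (phi : X -> X) (T : {linear H -> H}).
Hypothesis hT : is_composition_operator phi T.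

Definition push s : seq (R[i] * X) := [seq (p.1, phi p.2) | p <- s].

Lemma qform_push G s : qform G (push s) = qform (fun z w => G (phi z) (phi w)) s.
Proof.
rewrite /qform big_map; congr complex.Re; apply: eq_bigr => p _.
by rewrite big_map.
Qed.

(** The adjoint of the composition operator moves kernel functions along [phi]. *)
Lemma dot_composition f s : dot (T f) (comb s) = dot f (comb (push s)).
Proof.
by rewrite !dot_comb hT big_map.
Qed.

(** The vector [u = comb (push phi s)] satisfies [|u|^2 = <T u, comb s>], to which
    Cauchy-Schwarz applies; the adjoint itself need not be constructed. *)
Lemma qform_push_le (M : R) : (forall f, hnorm (T f) <= M * hnorm f) ->
  forall s, qform K (push s) <= M ^+ 2 * qform K s.
Proof.
move=> hM s; rewrite -!sqr_hnorm_comb; set u := comb (push s).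
have [->|u0] := eqVneq (hnorm u) 0.
  by rewrite expr0n mulr_ge0 ?sqr_ge0.
have {}u0 : 0 < hnorm u by rewrite lt_def u0 hnorm_ge0.
have : hnorm u ^+ 2 <= M * hnorm u * hnorm (comb s).
  rewrite [X in X <= _]sqr_hnorm -dot_composition.
  apply: le_trans (ler_norm _) (le_trans (normc_Re _) _).
  apply: le_trans (dot_Cauchy_Schwarz _ _) _.
  by rewrite ler_wpM2r ?hnorm_ge0.
rewrite mulrAC expr2 ler_pM2r // => h.
rewrite -exprMn ler_sqr ?nnegrE ?hnorm_ge0 //.
exact: le_trans (hnorm_ge0 u) h.
Qed.

(** By density it is enough to pair [T f] with combinations of kernel functions, and
    there the adjoint is explicit. *)
Lemma composition_le (B : R) : 0 <= B ->
  (forall s, qform K (push s) <= B ^+ 2 * qform K s) ->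
  forall f, hnorm (T f) <= B * hnorm f.
Proof.
move=> B0 hB f; set g := T f.
have [->|g0] := eqVneq (hnorm g) 0; first by rewrite mulr_ge0 ?hnorm_ge0.
have {}g0 : 0 < hnorm g by rewrite lt_def g0 hnorm_ge0.
have hs s : normc (dot g (comb s)) <= hnorm f * (B * hnorm (comb s)).
  rewrite dot_composition; apply: le_trans (dot_Cauchy_Schwarz _ _) _.
  rewrite ler_wpM2l ?hnorm_ge0 // -ler_sqr ?nnegrE ?mulr_ge0 ?hnorm_ge0 //.
  by rewrite exprMn !sqr_hnorm_comb.
apply/ler_addgt0Pr => e e0.
pose d := e * hnorm g / (hnorm g + hnorm f * B).
have c0 : 0 < hnorm g + hnorm f * B by rewrite ltr_pwDl // mulr_ge0 ?hnorm_ge0.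
have d0 : 0 < d by rewrite divr_gt0 ?mulr_gt0.
have [s hd] := comb_dense g d0.
have : hnorm g ^+ 2 <= hnorm g * d + hnorm f * (B * (hnorm g + d)).
  rewrite [X in X <= _]sqr_hnorm -[X in dot _ X](subrK (comb s)) dotDr ReD.
  apply: lerD.
    apply: le_trans (ler_norm _) (le_trans (normc_Re _) _).
    apply: le_trans (dot_Cauchy_Schwarz _ _) _.
    by rewrite ler_wpM2l ?hnorm_ge0 // ltW.
  apply: le_trans (ler_norm _) (le_trans (normc_Re _) (le_trans (hs s) _)).
  rewrite !ler_wpM2l ?hnorm_ge0 //.
  rewrite -[comb s](subKr g); apply: le_trans (hnormD _ _) _.
  by rewrite hnormN lerD2l ltW.
have -> : hnorm g * d + hnorm f * (B * (hnorm g + d)) =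
    hnorm g * (B * hnorm f + e).
  rewrite /d; field.
  by rewrite gt_eqF.
by rewrite expr2 ler_pM2l.
Qed.

End Composition.

End KernelSpace.

(** * Functions on the complex line: interpolation on circles and a Liouville theorem *)

Section RootsOfUnity.
Variable R : rcfType.

Lemma prim_root_exists (N : nat) : (0 < N)%N ->
  exists w : R[i], N.-primitive_root w.
Proof.
move=> N0; have [r Dr] := closed_field_poly_normal ('X^N - 1 : {poly R[i]}).
rewrite (monicP _) ?monicXnsubC // scale1r in Dr.
have root_r : all N.-unity_root r.
  by apply/allP => z; rewrite -root_prod_XsubC -Dr.
have uniq_r : uniq r.
  by rewrite -separable_prod_XsubC -Dr separable_Xn_sub_1 // pnatr_eq0 -lt0n.
have size_r : (N <= size r)%N.
  by rewrite -ltnS -(size_prod_XsubC r id) -Dr size_XnsubC.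
by have /hasP[w _ hw] := has_prim_root N0 root_r uniq_r size_r; exists w.
Qed.

(** Discrete orthogonality of the characters of the cyclic group of order [N]. *)
Lemma sum_prim_root (N : nat) (w : R[i]) (k m : nat) :
  N.-primitive_root w -> (m < N)%N ->
  \sum_(j < N) (w ^+ j) ^+ k / (w ^+ j) ^+ m = (((k %% N)%N == m) * N)%:R.
Proof.
move=> hw mN; have w0 : w != 0.
  apply/eqP => w0; have := prim_expr_order hw.
  rewrite w0 expr0n gtn_eqF ?(prim_order_gt0 hw) // => /eqP.
  by rewrite eq_sym oner_eq0.
pose y := w ^+ k / w ^+ m.
have -> : \sum_(j < N) (w ^+ j) ^+ k / (w ^+ j) ^+ m = \sum_(j < N) y ^+ j.
  apply: eq_bigr => j _.
  by rewrite /y expr_div_n -!exprM mulnC (mulnC j m).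
have y1 : (y == 1) = ((k %% N)%N == m).
  rewrite -(inj_eq (mulIf (expf_neq0 m w0))) mul1r divfK ?expf_neq0 //.
  by rewrite (eq_prim_root_expr hw) (modn_small mN).
rewrite -y1; have [->|yn1] := eqVneq y 1.
  by under eq_bigr do rewrite expr1n; rewrite sumr_const card_ord mul1n.
rewrite mul0n; apply: (mulfI (x := y - 1)); first by rewrite subr_eq0.
rewrite -subrX1 mulr0 /y expr_div_n -!exprM mulnC (mulnC m) !exprM.
by rewrite (prim_expr_order hw) !expr1n divr1 subrr.
Qed.

Lemma normc_prim_root (N : nat) (w : R[i]) : N.-primitive_root w -> normc w = 1.
Proof.
move=> hw; apply/eqP.
rewrite -(pexpr_eq1 (prim_order_gt0 hw)) ?normc_ge0 //.
by rewrite -normcX (prim_expr_order hw) normc1.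
Qed.

End RootsOfUnity.

Section Interpolation.
Variables (R : realType) (N : nat) (w : R[i]) (r : R).
Hypotheses (hw : N.-primitive_root w) (r0 : 0 < r).
Local Notation rC := (real_complex R r).

(** The discrete analogue of the Cauchy integral for the coefficient of degree [m],
    rescaled by [r ^+ m]. *)
Definition circle_coef (g : R[i] -> R[i]) (m : nat) : R[i] :=
  N%:R^-1 * \sum_(j < N) g (rC * w ^+ j) / (w ^+ j) ^+ m.

(** A functional written as a combination of point evaluations (with conjugated
    coefficients, as in [dot_comb]): it sends [g] to the difference at [x] between
    [g] and the polynomial of degree less than [N] that interpolates [g] at the
    nodes [r * w ^ j]. *)
Definition interpolation_error (x : R[i]) : seq (R[i] * R[i]) :=
  (1, x) :: [seq (- (N%:R^-1 * \sum_(m < N) (x / rC) ^+ m / (w ^+ j) ^+ m)^*,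
                  rC * w ^+ j) | j : 'I_N <- index_enum 'I_N].

Lemma interpolation_errorE g x :
  \sum_(p <- interpolation_error x) (p.1)^* * g p.2 =
  g x - \sum_(m < N) (x / rC) ^+ m * circle_coef g m.
Proof.
rewrite /interpolation_error big_cons /= rmorph1 mul1r; congr (_ + _).
rewrite big_map /= -sumrN [RHS](_ : _ = \sum_(m < N) \sum_(j < N)
   - (N%:R^-1 * ((x / rC) ^+ m / (w ^+ j) ^+ m) * g (rC * w ^+ j))).
  rewrite exchange_big; apply: eq_bigr => j _ /=.
  rewrite rmorphN /= conjCK sumrN mulNr; congr (- _).
  by rewrite mulr_sumr mulr_suml.
apply: eq_bigr => m _; rewrite sumrN /circle_coef; congr (- _).
rewrite mulrA mulr_sumr; apply: eq_bigr => j _.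
by ring.
Qed.

Lemma normc_node j : normc (rC * w ^+ j) = r.
Proof.
by rewrite normcM normcX (normc_prim_root hw) expr1n mulr1 normc_real gtr0_norm.
Qed.

Lemma circle_coef_le g b m : (forall x, normc x = r -> normc (g x) <= b) ->
  normc (circle_coef g m) <= b.
Proof.
move=> hg; have N0 : 0 < N%:R :> R by rewrite ltr0n (prim_order_gt0 hw).
rewrite /circle_coef normcM normcV normc_nat mulrC ler_pdivrMr //.
apply: le_trans (normc_sum _ _) _.
apply: (@le_trans _ _ (\sum_(j < N) b)).
  apply: ler_sum => j _.
  rewrite normcM normcV !normcX (normc_prim_root hw) !expr1n invr1 mulr1.
  by rewrite hg // normc_node.
by rewrite sumr_const card_ord mulr_natr.
Qed.

Lemma circle_coef_monomial k m : (m < N)%N ->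
  circle_coef (fun x => x ^+ k) m = ((k %% N)%N == m)%:R * rC ^+ k.
Proof.
move=> mN; have N0 : N%:R != 0 :> R[i].
  by rewrite pnatr_eq0 -lt0n (prim_order_gt0 hw).
rewrite /circle_coef (_ : \sum_(j < N) _ =
   rC ^+ k * \sum_(j < N) (w ^+ j) ^+ k / (w ^+ j) ^+ m).
  by rewrite (sum_prim_root _ hw mN) natrM; field.
by rewrite mulr_sumr; apply: eq_bigr => j _; rewrite exprMn mulrA.
Qed.

(** Aliasing: on the nodes the monomial of degree [k] agrees with the one of degree
    [k mod N].  In particular interpolation is exact below degree [N]. *)
Lemma moment_interpolation_error k x :
  \sum_(p <- interpolation_error x) (p.1)^* * p.2 ^+ k =
  x ^+ k - (x / rC) ^+ (k %% N) * rC ^+ k.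
Proof.
rewrite (interpolation_errorE (fun y => y ^+ k)); congr (_ - _).
have kN : (k %% N < N)%N by rewrite ltn_mod (prim_order_gt0 hw).
rewrite (bigD1 (Ordinal kN)) //= circle_coef_monomial // eqxx mul1r big1 ?addr0 //.
move=> m mk; rewrite circle_coef_monomial // (_ : (_ == _) = false) ?mul0r ?mulr0 //.
by apply/negbTE; rewrite eq_sym.
Qed.

End Interpolation.

Section Line.
Variables (R : realType) (sigma : R).
Hypothesis sigma0 : 0 <= sigma.
Implicit Types (s : seq (R[i] * R[i])).

Definition line_kernel (x y : R[i]) : R[i] :=
  cexp (x * y^* * real_complex R sigma).

Definition moment (k : nat) s : R[i] := \sum_(p <- s) (p.1)^* * p.2 ^+ k.

Lemma qform_line_monomial k s :
  qform (fun x y : R[i] => (x * y^*) ^+ k) s = normc (moment k s) ^+ 2.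
Proof.
rewrite sqr_normc_Re /qform /moment rmorph_sum; congr complex.Re.
rewrite mulr_suml exchange_big /=; apply: eq_bigr => p _.
rewrite mulr_sumr; apply: eq_bigr => q _.
by rewrite !rmorphM /= conjCK rmorphXn exprMn; ring.
Qed.

Lemma line_kernel_cvg s :
  \sum_(k < n) sigma ^+ k / k`!%:R * normc (moment k s) ^+ 2 @[n --> \oo] -->
  qform line_kernel s.
Proof.
have E n : qform (fun x y => cexp_partial n (x * y^* * real_complex R sigma)) s
    = \sum_(k < n) sigma ^+ k / k`!%:R * normc (moment k s) ^+ 2.
  rewrite /cexp_partial qform_sum; apply: eq_bigr => k _.
  rewrite -qform_line_monomial -qform_real; apply: eq_qform => x y.
  by rewrite exprMn rmorphM fmorphV rmorph_nat rmorphXn; ring.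
under eq_fun do rewrite -E.
by apply: cvg_qform => c x y; exact: cvg_cexp_partial.
Qed.

(** Only the moments of degree at least [N] contribute, and they are dominated by the
    tail of the exponential series at [r ^+ 2 * sigma]. *)
Lemma line_kernel_le (N : nat) (B r : R) s : 0 <= B -> 0 <= r ->
  (forall k, (k < N)%N -> moment k s = 0) ->
  (forall k, normc (moment k s) <= B * r ^+ k) ->
  qform line_kernel s <=
    B ^+ 2 * (expR (r ^+ 2 * sigma) * exp_coeff (r ^+ 2 * sigma) N).
Proof.
move=> B0 r0 m0 mB; set x := r ^+ 2 * sigma.
have x0 : 0 <= x by rewrite mulr_ge0 ?sqr_ge0.
pose S n := \sum_(k < n) x ^+ k / k`!%:R.
have ES n : complex.Re (1 * cexp_partial n (real_complex R x)) = S n.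
  rewrite mul1r /cexp_partial Re_sum; apply: eq_bigr => k _.
  by rewrite -rmorphXn -(rmorph_nat (real_complex R)) -fmorphV -rmorphM.
have cS : S n @[n --> \oo] --> expR x.
  have := @cvg_cexp_partial _ 1 (real_complex R x).
  by rewrite cexp_real mul1r; under eq_fun do rewrite ES.
have tail : expR x - S N <= expR x * exp_coeff x N.
  have := cexp_taylor N (real_complex R x).
  rewrite normc_real ger0_norm // cexp_real; apply: le_trans.
  apply: le_trans (ler_norm _) (le_trans _ (normc_Re _)).
  by rewrite ReB -ES mul1r.
have cT : B ^+ 2 * (S n - S N) @[n --> \oo] --> B ^+ 2 * (expR x - S N).
  by apply: cvgMr; apply: cvgB => //; exact: cvg_cst.
apply: (@le_trans _ _ (B ^+ 2 * (expR x - S N))); last first.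
  by rewrite ler_wpM2l ?sqr_ge0.
apply: (ler_cvg_to (@line_kernel_cvg s) cT).
near=> n; have Nn : (N <= n)%N by near: n; exact: nbhs_infty_ge.
rewrite /S -!(big_mkord xpredT (fun k => x ^+ k / k`!%:R)).
rewrite (big_cat_nat (n := N)) //= addrAC subrr add0r.
rewrite -(big_mkord xpredT (fun k => sigma ^+ k / k`!%:R * normc (moment k s) ^+ 2)).
rewrite (big_cat_nat (n := N)) //= big_nat_cond big1 ?add0r => [|k /andP[/andP[_ kN] _]].
  rewrite mulr_sumr; apply: ler_sum => k _.
  apply: (@le_trans _ _ (sigma ^+ k / k`!%:R * (B * r ^+ k) ^+ 2)).
    rewrite ler_wpM2l ?divr_ge0 ?exprn_ge0 //.
    by rewrite ler_sqr ?nnegrE ?normc_ge0 ?mulr_ge0 ?exprn_ge0.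
  have -> : sigma ^+ k / k`!%:R * (B * r ^+ k) ^+ 2 = B ^+ 2 * (x ^+ k / k`!%:R).
    by rewrite /x (exprMn _ (r ^+ 2)) (exprMn _ B) -!exprM (mulnC k); ring.
  exact: lexx.
by rewrite m0 // normc0 expr0n mulr0.
Unshelve. all: by end_near.
Qed.

(** Uniform polynomial approximation on a disc, with coefficients bounded by the
    values on the bounding circle.  It comes from [line_kernel_le] applied to
    [interpolation_error], whose moments vanish below [N] and are at most
    [2 * r ^+ k] beyond. *)
Lemma circle_approx (psi : R[i] -> R[i]) (C : R) : 0 <= C ->
  (forall s, normc (\sum_(p <- s) (p.1)^* * psi p.2) ^+ 2
             <= C * qform line_kernel s) ->
  forall r e, 0 < r -> 0 < e -> exists N : nat, exists A : nat -> R[i],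
    [/\ (1 < N)%N,
      forall m b, (forall x, normc x = r -> normc (psi x) <= b) ->
        normc (A m) <= b &
      forall x, normc x <= r ->
        normc (psi x - \sum_(m < N) (x / real_complex R r) ^+ m * A m) <= e].
Proof.
move=> C0 hpsi r e r0 e0; pose x := r ^+ 2 * sigma.
have : C * (2 ^+ 2 * expR x) * exp_coeff x n @[n --> \oo] -->
    C * (2 ^+ 2 * expR x) * 0.
  by apply: cvgMr; exact: cvg_exp_coeff.
rewrite mulr0 => /cvgrPdist_le /(_ (e ^+ 2) (exprn_gt0 2 e0)) [N0 _ hN0].
pose N := maxn N0 2; have N1 : (1 < N)%N by rewrite leq_maxr.
have /hN0 /= hN : (N0 <= N)%N by rewrite leq_maxl.
have [w hw] := @prim_root_exists R N (ltnW N1).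
exists N, (circle_coef N w r psi); split => // [m b hb|y yr].
  exact: circle_coef_le.
rewrite -ler_sqr ?nnegrE ?normc_ge0 ?(ltW e0) // -interpolation_errorE.
apply: le_trans (hpsi _) _.
rewrite sub0r normrN in hN; apply: le_trans (le_trans (ler_norm _) hN).
rewrite (_ : C * _ * _ = C * (2 ^+ 2 * (expR x * exp_coeff x N))); last by ring.
rewrite ler_wpM2l //.
apply: line_kernel_le; rewrite ?(ltW r0) // => k.
  move=> kN; rewrite /moment moment_interpolation_error // modn_small //.
  by rewrite expr_div_n divfK ?subrr // expf_neq0 // real_complex_eq0 gt_eqF.
rewrite /moment moment_interpolation_error //.
apply: le_trans (le_normcD _ _) _.
rewrite normcN normcM !normcX normcM normcV normc_real gtr0_norm // mulr_natl mulr2n.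
have q1 : normc y / r <= 1 by rewrite ler_pdivrMr // mul1r.
have q0 : 0 <= normc y / r by rewrite divr_ge0 ?normc_ge0 ?(ltW r0).
apply: lerD; first by rewrite lerXn2r ?nnegrE ?normc_ge0 ?(ltW r0).
by rewrite ler_piMl ?exprn_ge0 ?(ltW r0) // exprn_ile1.
Qed.

Lemma geometric_le2 (q : R) n : 0 <= q -> q <= 2^-1 -> \sum_(i < n) q ^+ i <= 2.
Proof.
move=> q0 q2; have := subrX1 q n; have := exprn_ge0 n q0.
have : 0 <= \sum_(i < n) q ^+ i by apply: sumr_ge0 => i _; rewrite exprn_ge0.
by move: (\sum_(i < n) _) (q ^+ n) => S Q; nra.
Qed.

(** Liouville: among the coefficients given by [circle_approx] those of degree at
    least 2 contribute [O(1 / r)] in total, because they are bounded by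
    [c * (1 + r)] and multiply powers of [x / r].  The combination
    [psi x - (1 - x) psi 0 - x psi 1] removes degrees 0 and 1. *)
Lemma linear_growth_affine (psi : R[i] -> R[i]) (C c : R) : 0 <= C -> 0 <= c ->
  (forall s, normc (\sum_(p <- s) (p.1)^* * psi p.2) ^+ 2
             <= C * qform line_kernel s) ->
  (forall x, normc (psi x) <= c * (1 + normc x)) ->
  forall x, psi x = (1 - x) * psi 0 + x * psi 1.
Proof.
move=> C0 c0 hpsi growth x; apply/eqP; rewrite -subr_eq0; apply/eqP.
apply: eq0_normc; set D := normc _; apply/eqP.
rewrite eq_le normc_ge0 andbT; apply/ler_addgt0Pl => e e0; rewrite addr0.
pose L := 1 + normc x; have L1 : 1 <= L by rewrite lerDl normc_ge0.
have Lp : 0 < L by lra.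
have xL : normc x <= L by rewrite lerDr.
(* The first summand makes [L / r] at most one half, the second makes the terms of
   degree at least 2 add up to at most [e / 2]. *)
pose r := 2 * L + 16 * c * L ^+ 2 / e.
have c16 : 0 <= 16 * c * L ^+ 2 by rewrite mulr_ge0 ?sqr_ge0 // mulr_ge0.
have r2 : 2 * L <= r by rewrite lerDl divr_ge0 // ltW.
have rp : 0 < r by lra.
have rc : 16 * c * L ^+ 2 <= r * e.
  rewrite -ler_pdivrMr // /r lerDr; lra.
have [|N [A [N1 hA hE]]] := circle_approx C0 hpsi rp (e := e / (6 * L)).
  by rewrite divr_gt0 // mulr_gt0.
pose S y := \sum_(m < N) (y / real_complex R r) ^+ m * A m.
pose E y := psi y - S y.
have {}hA m : normc (A m) <= c * (1 + r).
  by apply: hA => y <-; apply: growth.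
pose t m : R[i] := (x / real_complex R r) ^+ m
  - (1 - x) * (0 / real_complex R r) ^+ m - x * (1 / real_complex R r) ^+ m.
have DE : psi x - ((1 - x) * psi 0 + x * psi 1) =
    E x - (1 - x) * E 0 - x * E 1 + \sum_(m < N) t m * A m.
  have -> : \sum_(m < N) t m * A m = S x - (1 - x) * S 0 - x * S 1.
    rewrite /S !mulr_sumr -!sumrB; apply: eq_bigr => m _.
    by rewrite /t; ring.
  rewrite /E; move: (S x) (S 0) (S 1) => Sx S0 S1; ring.
have q0 : 0 <= L / r by rewrite divr_ge0 ?(ltW Lp) ?(ltW rp).
have q2 : L / r <= 2^-1 by rewrite ler_pdivrMr //; lra.
have r_ne0 : real_complex R r != 0 by rewrite real_complex_eq0 gt_eqF.
have normc_r : normc (real_complex R r) = r by rewrite normc_real gtr0_norm.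
have t_le m : normc (t m.+2) <= 2 * (L / r) ^+ m.+2.
  rewrite /t mul0r expr0n mulr0 subr0.
  apply: le_trans (le_normcD _ _) _; rewrite normcN (normcM x) !normcX !normcM !normcV.
  rewrite normc_r normc1 !expr_div_n expr1n mul1r.
  have rm : 0 < (r ^+ m.+2)^-1 by rewrite invr_gt0 exprn_gt0.
  rewrite -mulrDl mulrA ler_pM2r //.
  have h1 : normc x ^+ m.+2 <= L ^+ m.+2.
    by rewrite lerXn2r ?nnegrE ?normc_ge0 ?(ltW Lp) // lerDr.
  have h2 : normc x <= L ^+ m.+2.
    apply: (@le_trans _ _ L); first by rewrite lerDr.
    by rewrite ler_eXnr.
  lra.
have sum_le : normc (\sum_(m < N) t m * A m) <= e / 2.
  case: N N1 {hE E DE S} => [|[|n]] // _.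
  have t0 : t 0%N = 0 by rewrite /t !expr0 mulr1; ring.
  have t1 : t 1%N = 0 by rewrite /t !expr1; field.
  rewrite !big_ord_recl t0 t1 !mul0r !add0r.
  apply: le_trans (normc_sum _ _) _.
  apply: (@le_trans _ _ (2 * (L / r) ^+ 2 * (c * (1 + r)) * \sum_(i < n) (L / r) ^+ i)).
    rewrite mulr_sumr; apply: ler_sum => i _.
    rewrite normcM.
    apply: le_trans (ler_pM (normc_ge0 _) (normc_ge0 _) (t_le i) (hA _)) _.
    rewrite (_ : 2 * (L / r) ^+ i.+2 * _ =
      2 * (L / r) ^+ 2 * (c * (1 + r)) * (L / r) ^+ i); first exact: lexx.
    by rewrite (_ : (i : nat).+2 = (2 + i)%N) // exprD; ring.
  have B0 : 0 <= 2 * (L / r) ^+ 2 * (c * (1 + r)).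
    apply: mulr_ge0; first by rewrite mulr_ge0 ?exprn_ge0.
    by rewrite mulr_ge0 // addr_ge0 // ltW.
  apply: le_trans (ler_wpM2l B0 (geometric_le2 n q0 q2)) _.
  rewrite (_ : 2 * _ * _ * 2 = 4 * c * L ^+ 2 * (1 + r) / r ^+ 2); last first.
    by field; rewrite gt_eqF.
  rewrite ler_pdivrMr ?exprn_gt0 //.
  have h1 := mulr_ge0 c16 (_ : 0 <= r - 2); have {}h1 := h1 ltac:(lra).
  have h2 : 0 <= (r * e - 16 * c * L ^+ 2) * r.
    by rewrite mulr_ge0 ?subr_ge0 // ltW.
  have h3 : 0 <= e * r ^+ 2 by rewrite mulr_ge0 ?sqr_ge0 // ltW.
  move: h1 h2 h3 c16; rewrite (_ : 16 * c * L ^+ 2 = 4 * (4 * c * L ^+ 2)); last by ring.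
  move: (4 * c * L ^+ 2) => Q.
  nra.
set d := e / (6 * L) in hE.
have Ex : normc (E x) <= d by apply: hE; lra.
have E0 : normc (E 0) <= d by apply: hE; rewrite normc0; lra.
have E1 : normc (E 1) <= d by apply: hE; rewrite normc1; lra.
rewrite /D {}DE; move: (E x) (E 0) (E 1) (\sum_(m < N) t m * A m) Ex E0 E1 sum_le.
move=> Ex E0 E1 T e1 e2 e3 sum_le.
apply: le_trans (le_normcD _ _) _.
have nB (y z : R[i]) : normc (y - z) <= normc y + normc z.
  by apply: le_trans (le_normcD _ _) _; rewrite normcN.
have := nB (Ex - (1 - x) * E0) (x * E1); have := nB Ex ((1 - x) * E0).
rewrite (normcM (1 - x)) (normcM x).
have x1 : normc (1 - x) <= L by have := nB 1 x; rewrite normc1.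
have dL : d * L = e / 6 by rewrite /d; field; rewrite gt_eqF.
have d0 : 0 < d by rewrite divr_gt0 // mulr_gt0.
have e2' : normc (1 - x) * normc E0 <= L * d.
  by rewrite ler_pM ?normc_ge0.
have e1' : normc x * normc E1 <= L * d.
  by rewrite ler_pM ?normc_ge0.
have e3' : d <= d * L by rewrite ler_peMr // ltW.
lra.
Qed.

End Line.

(** * Symbols of bounded composition operators are affine *)

Section Cdot.
Variables (R : realType) (n : nat).
Implicit Types (x y z : 'rV[R[i]]_n) (a : R[i]).

Definition nsq x : R := complex.Re (cdot x x).

Lemma cdotDl x y z : cdot (x + y) z = cdot x z + cdot y z.
Proof.
by rewrite /cdot -big_split; apply: eq_bigr => j _; rewrite mxE mulrDl.
Qed.

Lemma cdotZl a x z : cdot (a *: x) z = a * cdot x z.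
Proof.
by rewrite /cdot mulr_sumr; apply: eq_bigr => j _; rewrite mxE mulrA.
Qed.

Lemma cdotC x y : cdot x y = (cdot y x)^*.
Proof.
rewrite /cdot rmorph_sum; apply: eq_bigr => j _.
by rewrite rmorphM /= conjCK mulrC.
Qed.

Lemma cdotDr x y z : cdot x (y + z) = cdot x y + cdot x z.
Proof. by rewrite cdotC cdotDl rmorphD /= -!cdotC. Qed.

Lemma cdotZr a x z : cdot x (a *: z) = a^* * cdot x z.
Proof. by rewrite cdotC cdotZl rmorphM /= -cdotC. Qed.

Lemma cdot0l x : cdot 0 x = 0.
Proof. by rewrite -(scale0r 0) cdotZl mul0r. Qed.

Lemma cdotBl x y z : cdot (x - y) z = cdot x z - cdot y z.
Proof. by rewrite -scaleN1r cdotDl cdotZl mulN1r. Qed.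

Lemma cdotBr x y z : cdot x (y - z) = cdot x y - cdot x z.
Proof. by rewrite cdotC cdotBl rmorphB /= -!cdotC. Qed.

Lemma nsqE x : nsq x = \sum_(j < n) normc (x 0 j) ^+ 2.
Proof.
by rewrite /nsq /cdot Re_sum; apply: eq_bigr => j _; rewrite sqr_normc_Re.
Qed.

Lemma nsq_ge0 x : 0 <= nsq x.
Proof. by rewrite nsqE sumr_ge0 // => j _; rewrite sqr_ge0. Qed.

Lemma cdot_self x : cdot x x = real_complex R (nsq x).
Proof.
rewrite nsqE rmorph_sum; apply: eq_bigr => j _.
by rewrite /= sqr_normcJ.
Qed.

Lemma nsqD x y : nsq (x + y) = nsq x + nsq y + 2 * complex.Re (cdot x y).
Proof.
rewrite /nsq cdotDl !cdotDr !ReD (cdotC y x) Re_conjc.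
by ring.
Qed.

Lemma nsqZ a x : nsq (a *: x) = normc a ^+ 2 * nsq x.
Proof.
rewrite !nsqE mulr_sumr; apply: eq_bigr => j _.
by rewrite mxE normcM exprMn.
Qed.

Lemma nsq_eq0 x : nsq x = 0 -> x = 0.
Proof.
rewrite nsqE => /eqP; rewrite psumr_eq0 => [|j _]; last exact: sqr_ge0.
move=> /allP h; apply/rowP => j; rewrite mxE; apply: eq0_normc.
by apply/eqP; have := h j (mem_index_enum j); rewrite /= sqrf_eq0.
Qed.

Lemma normc_coord_le x j : normc (x 0 j) ^+ 2 <= nsq x.
Proof.
by rewrite nsqE (bigD1 j) //= lerDl sumr_ge0 // => k _; rewrite sqr_ge0.
Qed.

End Cdot.

Section Affine.
Variables (R : realType) (n m : nat).
Implicit Types (s : seq (R[i] * 'rV[R[i]]_n)) (t : R).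

Definition fock_kernel (k : nat) (z w : 'rV[R[i]]_k) : R[i] := cexp (cdot z w).

Lemma qform_cdot s :
  qform (fun z w => cdot z w) s = nsq (\sum_(p <- s) (p.1)^* *: p.2).
Proof.
rewrite nsqE /qform -[RHS]/(complex.Re (real_complex R _)) rmorph_sum.
congr complex.Re.
have E j : real_complex R (normc ((\sum_(p <- s) (p.1)^* *: p.2) 0 j) ^+ 2) =
   \sum_(p <- s) \sum_(q <- s) p.1 * (q.1)^* * (q.2 0 j * (p.2 0 j)^*).
  rewrite /= sqr_normcJ summxE rmorph_sum mulr_suml exchange_big.
  apply: eq_bigr => p _ /=; rewrite mulr_sumr; apply: eq_bigr => q _.
  by rewrite !mxE rmorphM /= conjCK; ring.
under [RHS]eq_bigr do rewrite /= E.
rewrite [RHS]exchange_big; apply: eq_bigr => p _ /=.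
rewrite [RHS]exchange_big; apply: eq_bigr => q _ /=.
by rewrite -mulr_sumr.
Qed.

(** The terms of degree 0 and 1 of the exponential give the squared modulus of the
    sum of the coefficients and the squared norm of the weighted sum of the points.
    Both vanish, and the terms left are of order at least [t ^+ 4]. *)
Lemma qform_fock_dilation_le s :
  \sum_(p <- s) p.1 = 0 -> \sum_(p <- s) (p.1)^* *: p.2 = 0 ->
  exists G, 0 <= G /\ forall t, 0 <= t -> t <= 1 ->
    qform (@fock_kernel n) [seq (p.1, real_complex R t *: p.2) | p <- s]
    <= G * t ^+ 4.
Proof.
move=> s0 s1.
pose g (p q : R[i] * 'rV[R[i]]_n) := normc (cdot q.2 p.2).
exists (\sum_(p <- s) \sum_(q <- s)
  normc (p.1 * (q.1)^*) * (expR (g p q) * g p q ^+ 2)); split.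
  apply: sumr_ge0 => p _; apply: sumr_ge0 => q _.
  by rewrite mulr_ge0 ?normc_ge0 // mulr_ge0 ?expR_ge0 ?sqr_ge0.
move=> t t0 t1.
pose T (z w : 'rV[R[i]]_n) : R[i] := real_complex R (t ^+ 2) * cdot z w.
have -> : qform (@fock_kernel n) [seq (p.1, real_complex R t *: p.2) | p <- s] =
    qform (fun z w => cexp (T z w)) s.
  rewrite /qform big_map; congr complex.Re; apply: eq_bigr => p _.
  rewrite big_map; apply: eq_bigr => q _ /=; congr (_ * cexp _).
  by rewrite cdotZl cdotZr conj_real mulrA -rmorphM.
have T0 : qform (fun z w => cexp_partial 2 (T z w)) s = 0.
  rewrite /cexp_partial qform_sum !big_ord_recl big_ord0 /= addr0.
  rewrite (eq_qform (G' := fun _ _ => 1)); last first.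
    by move=> z w; rewrite expr0 fact0 divr1.
  rewrite qform_const s0 normc0 expr0n add0r.
  rewrite (eq_qform (G' := T)); last first.
    by move=> z w; rewrite expr1 divr1.
  rewrite /T qform_real qform_cdot s1 /nsq cdot0l mulr0 //.
have -> : qform (fun z w => cexp (T z w)) s =
    qform (fun z w => cexp (T z w) - cexp_partial 2 (T z w)) s.
  by rewrite qformB T0 subr0.
rewrite qformE mulr_suml.
apply: ler_sum => p _; rewrite mulr_suml; apply: ler_sum => q _.
apply: le_trans (ler_norm _) (le_trans (normc_Re _) _).
rewrite normcM -mulrA ler_wpM2l ?normc_ge0 //.
apply: le_trans (cexp_taylor _ _) _.
have -> : normc (T q.2 p.2) = t ^+ 2 * g p q.
  by rewrite normcM normc_real ger0_norm // sqr_ge0.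
have g0 : 0 <= g p q by exact: normc_ge0.
have tg0 : 0 <= t ^+ 2 * g p q by rewrite mulr_ge0 ?sqr_ge0.
have h1 : expR (t ^+ 2 * g p q) <= expR (g p q).
  by rewrite ler_expR ler_piMl // exprn_ile1.
have h2 : (t ^+ 2 * g p q) ^+ 2 / 2`!%:R <= g p q ^+ 2 * t ^+ 4.
  have : 0 <= g p q ^+ 2 * t ^+ 4 by rewrite mulr_ge0 ?exprn_ge0.
  rewrite (_ : _ ^+ 2 / 2`!%:R = g p q ^+ 2 * t ^+ 4 / 2); last first.
    by rewrite -[2`!]/2%N exprMn -exprM mulrC; ring.
  lra.
rewrite -[X in _ <= X]mulrA; apply: ler_pM; rewrite ?expR_ge0 //.
by rewrite divr_ge0 ?sqr_ge0.
Qed.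

Variables (phi : 'rV[R[i]]_n -> 'rV[R[i]]_m) (C c : R).
Hypothesis C0 : 0 <= C.
Hypothesis growth : forall z, nsq (phi z) <= nsq z + c.
Hypothesis dominated : forall s,
  nsq (\sum_(p <- s) (p.1)^* *: phi p.2) <= C * qform (@fock_kernel n) s.

(** On the line spanned by [z] the Fock kernel is [line_kernel (nsq z)], so each
    coordinate of [phi] falls under [linear_growth_affine]. *)
Lemma affine_on_lines (x : R[i]) z : phi (x *: z) = (1 - x) *: phi 0 + x *: phi z.
Proof.
apply/rowP => j; rewrite !mxE.
pose k := 1 + nsq z + `|c|.
have k1 : 1 <= k by rewrite /k -addrA lerDl addr_ge0 ?nsq_ge0.
have := @linear_growth_affine R (nsq z) (nsq_ge0 z) (fun x => phi (x *: z) 0 j) C k C0 _ _ _ x.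
rewrite scale0r scale1r; apply; first lra.
- move=> s; have := dominated [seq (p.1, p.2 *: z) | p <- s].
  rewrite big_map (_ : qform _ _ = qform (line_kernel (nsq z)) s); last first.
    rewrite /qform big_map; congr complex.Re; apply: eq_bigr => p _.
    rewrite big_map; apply: eq_bigr => q _ /=; congr (_ * cexp _).
    by rewrite cdotZl cdotZr cdot_self mulrA.
  apply: le_trans; apply: le_trans (normc_coord_le _ j).
  rewrite summxE; under [X in _ <= normc X ^+ 2]eq_bigr do rewrite mxE.
  exact: lexx.
- move=> y; have k0 : 0 <= k * (1 + normc y).
    by apply: mulr_ge0; [lra | rewrite addr_ge0 ?normc_ge0].
  rewrite -ler_sqr ?nnegrE ?normc_ge0 //.
  apply: le_trans (normc_coord_le _ j) (le_trans (growth _) _).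
  rewrite nsqZ exprMn; have y0 := normc_ge0 y; have z0 := nsq_ge0 z.
  have ck : c <= k by rewrite /k; have := ler_norm c; lra.
  have zk : nsq z <= k by rewrite /k; have := normr_ge0 c; lra.
  have kk : k <= k ^+ 2 by rewrite expr2 ler_peMl //; lra.
  have h1 : normc y ^+ 2 * nsq z <= normc y ^+ 2 * k ^+ 2.
    by rewrite ler_wpM2l ?sqr_ge0 //; lra.
  have h2 := mulr_ge0 (sqr_ge0 k) y0.
  nra.
Qed.

(** The second difference [d] of [phi] scales like [t] along lines, while it is
    bounded by the norm of a second difference of kernel functions, of order
    [t ^+ 2]; hence [nsq d] is at most a multiple of [t ^+ 2]. *)
Lemma additive_part u v :
  phi (u + v) - phi 0 = (phi u - phi 0) + (phi v - phi 0).
Proof.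
apply/eqP; rewrite -subr_eq0; apply/eqP; apply: nsq_eq0; set d := _ - _.
pose s := [:: (1, u + v); (-1, u); (-1, v); (1, 0)] : seq (R[i] * 'rV[R[i]]_n).
have [||G [G0 hG]] := @qform_fock_dilation_le s.
- by rewrite /s !big_cons big_nil /=; ring.
- rewrite /s !big_cons big_nil /= rmorphN1 rmorph1 !scaleN1r !scale1r !addr0.
  by rewrite addrACA subrr add0r subrr.
have small t : 0 < t -> t <= 1 -> nsq d <= C * G * t ^+ 2.
  move=> t0 t1; have := dominated [seq (p.1, real_complex R t *: p.2) | p <- s].
  have -> : \sum_(p <- [seq (p.1, real_complex R t *: p.2) | p <- s])
      (p.1)^* *: phi p.2 = real_complex R t *: d.
    rewrite /s !big_cons big_nil /= rmorphN1 rmorph1 !scaleN1r !scale1r !addr0.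
    rewrite scaler0 !affine_on_lines /d; apply/rowP => j; rewrite !mxE; ring.
  rewrite nsqZ normc_real gtr0_norm // => h.
  rewrite -(ler_pM2l (exprn_gt0 2 t0)); apply: le_trans h _.
  apply: le_trans (ler_wpM2l C0 (hG t (ltW t0) t1)) _.
  by rewrite (_ : C * (G * t ^+ 4) = t ^+ 2 * (C * G * t ^+ 2)) ?lexx //; ring.
apply/eqP; rewrite eq_le nsq_ge0 andbT; apply/ler_addgt0Pl => e e0; rewrite addr0.
have CG : 0 <= C * G by rewrite mulr_ge0.
pose t := Num.min 1 (e / (1 + C * G)).
have t0 : 0 < t by rewrite lt_min ltr01 divr_gt0 // ltr_pwDl.
have t1 : t <= 1 by rewrite ge_min lexx.
apply: le_trans (small t t0 t1) _.
have te : t * (1 + C * G) <= e.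
  by rewrite -ler_pdivlMr ?ltr_pwDl // ge_min lexx orbT.
have t2 : t ^+ 2 <= t by rewrite expr2 ler_piMl // ltW.
have := ler_wpM2l CG t2; lra.
Qed.

Lemma phi_affine : exists A : 'M[R[i]]_(n, m), forall z, phi z = z *m A + phi 0.
Proof.
pose l z := phi z - phi 0.
have lD u v : l (u + v) = l u + l v by exact: additive_part.
have lZ x z : l (x *: z) = x *: l z.
  by rewrite /l affine_on_lines; apply/rowP => j; rewrite !mxE; ring.
have l0 : l 0 = 0 by rewrite /l subrr.
exists (\matrix_(i < n) l (delta_mx 0 i)) => z.
apply/eqP; rewrite -subr_eq -/(l z); apply/eqP.
rewrite mulmx_sum_row [in LHS](row_sum_delta z) (big_morph _ lD l0).
by apply: eq_bigr => i _; rewrite lZ rowK.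
Qed.

End Affine.

(** * Completing the square *)

Section Quadratic.
Variables (R : realType) (n m : nat).
Local Notation C := (R[i]).
Local Notation "M ^H" := (map_mx Num.conj M^T) (at level 8, format "M ^H").

Lemma cdotE k (x y : 'rV[C]_k) : cdot x y = (x *m y^H) 0 0.
Proof. by rewrite mxE; apply: eq_bigr => j _; rewrite !mxE. Qed.

Lemma adjmx_mul p q r (A : 'M[C]_(p, q)) (B : 'M[C]_(q, r)) :
  (A *m B)^H = B^H *m A^H.
Proof. by rewrite trmx_mul map_mxM. Qed.

Lemma adjmxK p q (A : 'M[C]_(p, q)) : A^H^H = A.
Proof. by apply/matrixP => i j; rewrite !mxE conjCK. Qed.

Lemma cdot_mulmxl p q (x : 'rV[C]_p) (A : 'M[C]_(p, q)) y :
  cdot (x *m A) y = cdot x (y *m A^H).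
Proof. by rewrite !cdotE adjmx_mul adjmxK mulmxA. Qed.

Variables (A : 'M[C]_(n, m)) (b : 'rV[C]_m) (c : R).
Hypothesis growth : forall z, nsq (z *m A + b) <= nsq z + c.

(** The Hermitian form [|x|^2 - |x A|^2], that is minus the quadratic part of
    [nsq (x *m A + b) - nsq x]. *)
Definition defect : 'M[C]_n := 1%:M - A *m A^H.

Lemma defect_herm : defect^H = defect.
Proof.
rewrite /defect; apply/matrixP => i j; rewrite !mxE rmorphB /=.
rewrite rmorph_nat eq_sym rmorph_sum; congr (_ - _).
by apply: eq_bigr => k _; rewrite !mxE rmorphM /= conjCK mulrC.
Qed.

Lemma cdot_defect x y : cdot (x *m defect) y = cdot x y - cdot (x *m A) (y *m A).
Proof.
by rewrite /defect mulmxBr mulmx1 cdotBl mulmxA (cdot_mulmxl (x *m A)) adjmxK.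
Qed.

(** A quadratic polynomial bounded above on the line has nonpositive leading
    coefficient.  The contradiction is taken at [t] and [- t], whose linear terms
    cancel. *)
Lemma bounded_line (u v w : R) : (forall t, t ^+ 2 * u + t * v <= w) -> u <= 0.
Proof.
move=> h; rewrite leNgt; apply/negP => u0.
have w0 : 0 <= w by have := h 0; rewrite expr0n !mul0r addr0.
pose t := 1 + w / u.
have tu : t * u = u + w by rewrite /t mulrDl mul1r divfK // gt_eqF.
have t1 : 1 <= t by rewrite lerDl divr_ge0 // ltW.
have := h t; have := h (- t); rewrite sqrrN expr2 -mulrA tu mulNr => h1 h2.
have : t * (u + w) <= w by lra.
have : u + w <= t * (u + w) by rewrite ler_peMl // addr_ge0 // ltW.
lra.
Qed.

Lemma growth_scaled x a :
  normc a ^+ 2 * (nsq (x *m A) - nsq x) + 2 * complex.Re (a * cdot (x *m A) b)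
    <= c - nsq b.
Proof.
have := growth (a *: x); rewrite -scalemxAl nsqD !nsqZ cdotZl; lra.
Qed.

Lemma contraction x : nsq (x *m A) <= nsq x.
Proof.
rewrite -subr_le0; apply: (@bounded_line _ (2 * complex.Re (cdot (x *m A) b)) (c - nsq b)).
move=> t; have := growth_scaled x (real_complex R t).
rewrite normc_real real_normK ?num_real // Re_realM; lra.
Qed.

(** Where the quadratic part vanishes on the complex line of [x], what remains is an
    affine function that is bounded above, hence constant. *)
Lemma isotropic_orthogonal x : nsq (x *m A) = nsq x -> cdot (x *m A) b = 0.
Proof.
move=> e; set d := cdot _ _; have h a := growth_scaled x a.
apply: eq0_normc; apply/eqP; rewrite -sqrf_eq0 eq_le sqr_ge0 andbT leNgt.
apply/negP => d0.
pose t := (1 + `|c - nsq b|) / normc d ^+ 2.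
have := h (real_complex R t * d^*); rewrite e subrr mulr0 add0r -mulrA Re_realM.
rewrite (mulrC d^*) -sqr_normc_Re divfK ?gt_eqF //.
have := ler_norm (c - nsq b); have := normr_ge0 (c - nsq b); lra.
Qed.

(** The equation for a critical point of [nsq (z *m A + b) - nsq z].  It is solvable
    because the right-hand side is orthogonal to the kernel of the Hermitian matrix
    [defect], which is [isotropic_orthogonal]. *)
Lemma critical_point : exists w, w *m defect = b *m A^H.
Proof.
suff /submxP[w hw] : (b *m A^H <= defect)%MS by exists w.
rewrite submxE; have := mulmx_coker defect; move: (cokermx defect) => K hK.
apply/eqP/rowP => j; rewrite [RHS]mxE.
pose x := (col j K)^H.
have xP : x *m defect = 0.
  rewrite -defect_herm -adjmx_mul colE mulmxA hK mul0mx.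
  by apply/matrixP => i k; rewrite !mxE rmorph0.
have e : nsq (x *m A) = nsq x.
  by apply/eqP; rewrite eq_sym -subr_eq0 /nsq -ReB -cdot_defect xP cdot0l.
have := isotropic_orthogonal e; rewrite cdot_mulmxl cdotC => /eqP.
rewrite conjC_eq0 cdotE /x adjmxK => /eqP h.
by rewrite -[RHS]h colE (mulmxA (b *m A^H) K) -colE [RHS]mxE.
Qed.

(** A square root through the spectral theorem; the eigenvalues are nonnegative
    because [A] is a contraction. *)
Lemma defect_factor : exists B : 'M[C]_n, defect = B *m B^H.
Proof.
have /orthomx_spectralP hP : defect \is normalmx.
  by apply/normalmxP; rewrite -/(defect^H) defect_herm.
set U := spectralmx defect in hP; set d := spectral_diag defect in hP.
have Uu : U \is unitarymx by exact: spectral_unitarymx.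
have UV : U *m U^H = 1%:M by apply/unitarymxP.
have hP' : defect = U^H *m diag_mx d *m U.
  by rewrite -(invmx_unitary Uu).
have d0 i : 0 <= d 0 i.
  have E : cdot (row i U *m defect) (row i U) = d 0 i.
    rewrite hP' cdotE rowE adjmx_mul !mulmxA -(mulmxA _ U) UV mulmx1.
    rewrite -(mulmxA (_ *m diag_mx d)) UV mulmx1 trmx_delta map_delta_mx.
    by rewrite -rowE -colE !mxE eqxx mulr1n.
  rewrite -E cdot_defect !cdot_self -rmorphB ler0c subr_ge0.
  exact: contraction.
clear hP; clearbody d U; pose e := map_mx sqrtC d.
exists (U^H *m diag_mx e).
suff De : diag_mx d = diag_mx e *m (diag_mx e)^H.
  rewrite hP' {}De adjmx_mul adjmxK; move: (diag_mx e) => E.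
  by rewrite (mulmxA U^H E) -(mulmxA (U^H *m E)).
apply/matrixP => i j; rewrite mul_diag_mx !mxE.
case: eqVneq => [->|ij]; last by rewrite !mulr0n rmorph0 mulr0.
rewrite !mulr1n geC0_conj ?sqrtC_ge0 //.
by rewrite -expr2 sqrtCK.
Qed.

(** Expanding around a critical point [w] makes the mixed terms vanish; the constant
    left is the value at [w], and the form left is [defect = B B^H]. *)
Lemma complete_square : exists (w : 'rV[C]_n) (B : 'M[C]_n), forall x y,
  cdot x y + real_complex R (nsq (w *m A + b) - nsq w) =
  cdot (x *m A + b) (y *m A + b) + cdot ((x - w) *m B) ((y - w) *m B).
Proof.
have [w hw] := critical_point; have [B hB] := defect_factor.
exists w, B => x y.
have E u v : cdot (u *m B) (v *m B) = cdot u v - cdot (u *m A) (v *m A).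
  by rewrite -cdot_defect hB mulmxA (cdot_mulmxl (u *m B)) adjmxK.
have Eb u : cdot b (u *m A) = cdot w u - cdot (w *m A) (u *m A).
  by rewrite -cdot_defect hw cdot_mulmxl adjmxK.
have Eb' u : cdot (u *m A) b = cdot u w - cdot (u *m A) (w *m A).
  by rewrite cdotC Eb rmorphB /= -!cdotC.
rewrite rmorphB /= -!cdot_self E !mulmxBl.
rewrite !cdotBl !cdotBr !cdotDl !cdotDr !Eb !Eb'.
ring.
Qed.

End Quadratic.

(** * Norm attainment *)

Section Attaining.
Variables (R : realType) (X : Type) (K : X -> X -> R[i]) (H : rkhs K).

Lemma sqr_hnorm_ker z : hnorm (rkhs_ker z : H) ^+ 2 = complex.Re (K z z).
Proof. by rewrite sqr_hnorm rkhs_reproducing rkhs_kerE. Qed.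

Lemma hnormZ_ge0 (a : R) (f : H) : 0 <= a ->
  hnorm (real_complex R a *: f) = a * hnorm f.
Proof.
move=> a0; apply: (@pexpIrn _ 2); rewrite ?nnegrE ?mulr_ge0 ?hnorm_ge0 //.
by rewrite sqr_hnormZ normc_real ger0_norm // exprMn.
Qed.

Lemma operator_norm_eq (T : {linear H -> H}) (B : R) (f : H) :
  0 <= B -> (forall g, hnorm (T g) <= B * hnorm g) ->
  hnorm f = 1 -> B <= hnorm (T f) -> hnorm (T f) = operator_norm T.
Proof.
move=> B0 hB f1 hf.
have ub : ubound [set hnorm (T g) | g in [set g : H | hnorm g <= 1]] B.
  move=> _ [g /= g1 <-]; apply: le_trans (hB g) _.
  by rewrite ler_piMr.
have inS : [set hnorm (T g) | g in [set g : H | hnorm g <= 1]] (hnorm (T f)).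
  by exists f => //=; rewrite f1.
apply/eqP; rewrite eq_le; apply/andP; split.
  by apply: ub_le_sup inS; exists B.
by apply: le_trans hf; apply: ge_sup ub; exists (hnorm (T f)).
Qed.

(** Pairing with the kernel function at [w] shows that [T] stretches the kernel
    function at [phi w] by at least [hnorm K_(phi w) / hnorm K_w = B]. *)
Lemma norm_attaining_kernel (phi : X -> X) (T : {linear H -> H}) (w : X) (B : R) :
  is_composition_operator phi T -> 0 <= B ->
  (forall f, hnorm (T f) <= B * hnorm f) ->
  0 < hnorm (rkhs_ker w : H) -> 0 < hnorm (rkhs_ker (phi w) : H) ->
  hnorm (rkhs_ker (phi w) : H) = B * hnorm (rkhs_ker w : H) ->
  norm_attaining T.
Proof.
move=> hT B0 hB kw0 kp0 kE; set k := rkhs_ker (phi w) in kp0 kE.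
have Tk : hnorm k ^+ 2 <= hnorm (T k) * hnorm (rkhs_ker w : H).
  have -> : hnorm k ^+ 2 = complex.Re (rkhs_dot (T k) (rkhs_ker w)).
    by rewrite rkhs_reproducing hT /= sqr_hnorm_ker rkhs_kerE.
  exact: le_trans (ler_norm _) (le_trans (normc_Re _) (dot_Cauchy_Schwarz _ _)).
have ik0 : 0 <= (hnorm k)^-1 by rewrite invr_ge0 ltW.
exists (real_complex R (hnorm k)^-1 *: k).
have n1 : hnorm (real_complex R (hnorm k)^-1 *: k) = 1.
  by rewrite hnormZ_ge0 // mulVf // gt_eqF.
split => //; apply: (operator_norm_eq B0 hB n1).
rewrite linearZ /= hnormZ_ge0 // ler_pdivlMl //.
by rewrite -(ler_pM2r kw0); apply: le_trans Tk; rewrite expr2 {2}kE; lra.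
Qed.

End Attaining.

Section Fock.
Variables (R : realType) (n : nat) (H : fock_space R n).
Variables (phi : 'rV[R[i]]_n -> 'rV[R[i]]_n) (T : {linear H -> H}).
Hypothesis hT : is_composition_operator phi T.
Variable M : R.
Hypothesis hM : forall f : H, hnorm (T f) <= M * hnorm f.
Local Notation K := (@fock_kernel R n).

Lemma sqr_hnorm_fock_ker z : hnorm (rkhs_ker z : H) ^+ 2 = expR (nsq z).
Proof. by rewrite sqr_hnorm_ker cdot_self cexp_real. Qed.

Lemma hnorm_fock_ker_gt0 z : 0 < hnorm (rkhs_ker z : H).
Proof.
rewrite lt_def hnorm_ge0 andbT; apply/eqP => h.
by have := expR_gt0 (nsq z); rewrite -sqr_hnorm_fock_ker h expr0n ltxx.
Qed.

Lemma fock_psd : psd K.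
Proof. by move=> s; rewrite -(sqr_hnorm_comb H) sqr_ge0. Qed.

(** The inequality [qform_push_le] for a single kernel function. *)
Lemma fock_growth z : nsq (phi z) <= nsq z + ln (M ^+ 2).
Proof.
have := qform_push_le hT hM [:: (1, z)].
rewrite -!(sqr_hnorm_comb H) !comb1 !scale1r !sqr_hnorm_fock_ker => h.
have M0 : 0 < M ^+ 2.
  rewrite lt_def sqr_ge0 andbT; apply/eqP => M0.
  by have := expR_gt0 (nsq (phi z)); rewrite ltNge => /negP; apply; rewrite M0 mul0r in h.
by rewrite -ler_expR expRD lnK ?posrE // mulrC.
Qed.

(** By [psd_cexp_cdot] without its term of degree 1, the Gram kernel of [phi] lies
    below [exp <phi z, phi w>], and the latter lies below [M ^+ 2 * K]. *)
Lemma fock_dominated s :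
  nsq (\sum_(p <- s) (p.1)^* *: phi p.2) <= M ^+ 2 * qform K s.
Proof.
apply: le_trans (qform_push_le hT hM s).
have -> : \sum_(p <- s) (p.1)^* *: phi p.2 =
    \sum_(p <- push phi s) (p.1)^* *: p.2 by rewrite big_map.
rewrite -qform_cdot -subr_ge0 -qformB.
rewrite (eq_qform (G' := fun z w => (cexp (cdot z w) -
  cdot z w ^+ 1 / 1`!%:R) * 1)); first exact: (psd_cexp_cdot id 1%N (@psd1 R _)).
by move=> z w; rewrite expr1 divr1 mulr1.
Qed.

Theorem fock_norm_attaining : norm_attaining T.
Proof.
have [A hA] := phi_affine (sqr_ge0 M) fock_growth fock_dominated.
set b := phi 0 in hA.
have growthA z : nsq (z *m A + b) <= nsq z + ln (M ^+ 2).
  by rewrite -hA; exact: fock_growth.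
have [w [B hsq]] := complete_square growthA.
set c := nsq _ - nsq w in hsq.
have B0 := ltW (expR_gt0 (c / 2)).
have B2 : expR (c / 2) ^+ 2 = expR c.
  by rewrite expr2 -expRD; congr expR; lra.
apply: (@norm_attaining_kernel _ _ _ H phi T w (expR (c / 2))) => //;
  rewrite ?hnorm_fock_ker_gt0 //; last first.
  apply: (@pexpIrn _ 2); rewrite ?nnegrE ?mulr_ge0 ?hnorm_ge0 //.
  rewrite exprMn !sqr_hnorm_fock_ker B2 -expRD; congr expR.
  by rewrite /c hA; lra.
apply: (composition_le hT B0) => s; rewrite qform_push B2.
rewrite -subr_ge0 -qform_real -qformB.
have psdphi : psd (fun z w => K (phi z) (phi w)).
  by move=> r; rewrite -qform_push; exact: fock_psd.
rewrite (eq_qform (G' := fun z u => (cexp (cdot ((z - w) *m B) ((u - w) *m B)) -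
  cdot ((z - w) *m B) ((u - w) *m B) ^+ 0 / 0`!%:R) * K (phi z) (phi u))).
  exact: (psd_cexp_cdot (fun z => (z - w) *m B) 0%N psdphi).
move=> z u; rewrite expr0 fact0 divr1 mulrBl mul1r; congr (_ - _).
rewrite -cexp_real -!cexpD addrC hsq !hA addrC //.
Qed.

End Fock.

Theorem corollary3p7 (R : realType) (n : nat) (hn : (1 <= n)%N)
    (H : fock_space R n) (phi : 'rV[R[i]]_n -> 'rV[R[i]]_n)
    (C_phi : {linear H -> H})
    (hC : is_composition_operator phi C_phi)
    (hb : bounded_operator C_phi) :
  norm_attaining C_phi.
Proof. by have [M hM] := hb; exact: (@fock_norm_attaining R n H phi C_phi hC M hM). Qed.
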